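(* Let $N$ be a prime, and for $g\in\mathbb{Z}/N\mathbb{Z}$ let $$F_g^{(N)}(\tau)=\begin{cases}-\ell_NE_2(\tau)&\text{if }g=e,\\ -\ell_NE_{2,N}(\tau)&\text{if }g\neq e.\end{cases}$$ Then the canonically twisted module $W^{(N)}_{\mathrm{tw}}=\bigoplus_nW^{(N)}_{\mathrm{tw},n}$ of $W^{(N)}$ constructed in the context, with the generator of $\mathbb{Z}/N\mathbb{Z}$ acting as $\gamma\sigma$, is an infinite-dimensional virtual graded module for $\mathbb{Z}/N\mathbb{Z}$ such that for every $g\in \mathbb{Z}/N\mathbb{Z}$ $$F_g^{(N)}(\tau)=\sum_{n=0}^\infty\mathrm{tr}(g\mid W^{(N)}_{\mathrm{tw},n})\,q^n,$$ where the trace on the virtual module is the one weighted by the operator $\widetilde p(0)\left(L_1(0)-\frac{c_1}{24}\right)$; that is, for every integer $k$, $$\mathrm{tr}\left((\gamma\sigma)^k\,\widetilde p(0)\left(L_1(0)-\tfrac{c_1}{24}\right)q^{L(0)-\frac{c}{24}}\,\Big|\,W^{(N)}_{\mathrm{tw}}\right)=\begin{cases}-\ell_NE_2(\tau)&\text{if }N\mid k,\\-\ell_NE_{2,N}(\tau)&\text{if }N\nmid k.\end{cases}$$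
   Context: Notation: $q=e^{2\pi i\tau}$; $E_2(\tau)=1-24\sum_{n\ge1}\sigma_1(n)q^n$; $\ell_N=\mathrm{num}\left(\frac{N^2-1}{24}\right)$ (numerator in lowest terms; so $\ell_N=\frac{N^2-1}{24}$ for $N>3$ and $\ell_2=\ell_3=1$); $E_{2,N}(\tau)=\frac{1}{N^2-1}\left(N^2E_2(N\tau)-E_2(\tau)\right)$. Set $(M,r)=(N^2,1)$ if $N>3$, $(32,8)$ if $N=2$, and $(27,3)$ if $N=3$; thus $M-r=24\ell_N$. First factor. Let $\mathfrak h=\mathbb{C}^{24\ell_N}$ with a non-degenerate symmetric bilinear form preserved by an automorphism $\gamma$ of $\mathfrak h$ of order $N$ with characteristic polynomial $(x^N-1)^{M/N}/(x-1)^r$. Let $V=S(b_i(-n)\mid n>0,\ 1\le i\le 24\ell_N)$ be the Heisenberg vertex algebra of $\mathfrak h$ (symmetric algebra on $\bigoplus_{n>0}\mathfrak h\otimes t^{-n}$), $L_1(0)$ its degree operator ($b_i(-n)$ has degree $n$), $c_1=24\ell_N$ its central charge; $\gamma$ extends to $V$ by algebra automorphisms acting on each $\mathfrak h\otimes t^{-n}$ as on $\mathfrak h$. Second factor. Let $\mathfrak p=\mathbb{C}p$ be one-dimensional with symmetric bilinear form $\langle p,p\rangle=-2$; the Clifford algebras are normalized so that $p(m)p(n)+p(n)p(m)=2\delta_{m+n,0}$, where $p(m)=p\otimes t^m$, $m\in\mathbb{Z}+\frac12$ for $\hat{\mathfrak p}=\mathfrak p[t,t^{-1}]t^{1/2}$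 and $m\in\mathbb{Z}$ for $\hat{\mathfrak p}_{\mathrm{tw}}=\mathfrak p[t,t^{-1}]$. $A(\mathfrak p)$ is the Clifford module super vertex operator algebra induced from a vacuum $v$ with $p(m)v=0$ for $m>0$, with Virasoro element $\frac14p(-3/2)p(-1/2)v$ and central charge $\frac12$. $A(\mathfrak p)^+_{\mathrm{tw}}$ is the $\mathrm{Cliff}(\hat{\mathfrak p}_{\mathrm{tw}})$-module generated by a vector $v^+_{\mathrm{tw}}$ with $p(n)v^+_{\mathrm{tw}}=0$ for $n>0$ and $p(0)v^+_{\mathrm{tw}}=v^+_{\mathrm{tw}}$; it is isomorphic to $\bigwedge(p(-n)\mid n>0)v^+_{\mathrm{tw}}$, and it is a canonically twisted module for $A(\mathfrak p)$ via $p(-1/2)v\mapsto\sum_{n\in\mathbb{Z}}p(n)z^{-n-1/2}$. On it $L(0)$ acts as $\frac1{16}+\frac12\sum_{n>0}n\,p(-n)p(n)$, i.e. $p(-n_1)\cdots p(-n_k)v^+_{\mathrm{tw}}$ has $L(0)$-eigenvalue $\frac1{16}+\sum n_i$, and $p(0)$ acts on this vector as $(-1)^k$. Put $\widetilde A(\mathfrak p)=A(\mathfrak p_1)\otimes\cdots\otimes A(\mathfrak p_M)$ and $\widetilde A(\mathfrak p)_{\mathrm{tw}}=A(\mathfrak p_1)^+_{\mathrm{tw}}\otimes\cdots\otimes A(\mathfrak p_M)^+_{\mathrm{tw}}$ with each $\mathfrak p_i$ a copy of $\mathfrak p$; $\widetilde p(0)=p_1(0)\otimes\cdots\otimes p_M(0)$;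 $L_2(0)$ is the sum of the $L(0)$ operators of the factors and $c_2=M/2$. The operator $\sigma$ permutes the tensor factors by a permutation of $\{1,\dots,M\}$ of cycle shape $N^{M/N}$, the factors being regarded as super vector spaces in which the vector $p_i(-n_1)\cdots p_i(-n_k)v^+_{\mathrm{tw}}$ ($n_1,\dots,n_k>0$) of the $i$-th factor $A(\mathfrak p_i)^+_{\mathrm{tw}}$ has parity $(-1)^k$, i.e. is even or odd according to whether $k$ is even or odd (Koszul sign rule); equivalently $\sigma$ is the automorphism of the exterior algebra on all $p_i(-n)$ sending $p_i(-n)$ to $p_{\sigma(i)}(-n)$. Third factor. $U$ is the Heisenberg vertex algebra of $\mathbb{C}^r$, with degree operator $L_3(0)$ and central charge $c_3=r$. Put $W^{(N)}=V\otimes\widetilde A(\mathfrak p)\otimes U$ and $W^{(N)}_{\mathrm{tw}}=V\otimes\widetilde A(\mathfrak p)_{\mathrm{tw}}\otimes U$; $\gamma,\sigma,\widetilde p(0),L_i(0)$ act on $W^{(N)}_{\mathrm{tw}}$ through the tensor factor on which they were defined and trivially on the others. $L(0)=L_1(0)+L_2(0)+L_3(0)$ and $c=c_1+c_2+c_3$. $W^{(N)}_{\mathrm{tw},n}$ is the eigenspace of $L(0)-\frac c{24}$ with eigenvalue $n$; it is regarded as the virtual $\mathbb{Z}/N\mathbb{Z}$-module $\sum_{m,\epsilon}\epsilon m\,[W_n^{m,\epsilon}]$, where $W_n^{m,\epsilon}$ is the joint eigenspace in $W^{(N)}_{\mathrm{tw},n}$ on which $L_1(0)-\frac{c_1}{24}=m\in\mathbb{Z}$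 and $\widetilde p(0)=\epsilon\in\{\pm1\}$, with the generator acting by $\gamma\sigma$. *)

(* Defs.v *)
From HB Require Import structures.
From mathcomp Require Import all_boot all_order all_fingroup all_algebra.
From mathcomp Require Import all_classical all_reals all_analysis.
From mathcomp Require Import finmap complex.
(* The notations of monalg clash with those of mathcomp-analysis. *)
From mathcomp.multinomials Require Import -(notations) monalg.
Set Implicit Arguments.
Unset Strict Implicit.
Unset Printing Implicit Defensive.
Import Order.TTheory GRing.Theory Num.Theory numFieldNormedType.Exports.
Local Open Scope classical_set_scope.
Local Open Scope ring_scope.

(* [malg K F] is the F-vector space with basis K, and [ket k] is the basis
   vector of index k. *)
Notation ket k := (mkmalgU k 1).

Section LinearAlgebra.
Context {F : fieldType}.

Definition lext {K : choiceType} {W : lmodType F} (f : K -> W)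
    (u : malg K F) : W :=
  \sum_(k <- msupp u) mcoeff k u *: f k.

Section Subspaces.
Context {W : lmodType F}.

Definition is_basis (P : set W) n (b : 'I_n -> W) : Prop :=
  (forall w, P w <-> exists a : 'I_n -> F, w = \sum_i a i *: b i) /\
  (forall a : 'I_n -> F, \sum_i a i *: b i = 0 -> forall i, a i = 0).

Definition findim (P : set W) : Prop := exists n (b : 'I_n -> W), is_basis P b.

(* The trace of T on a finite-dimensional T-stable subspace P, with junk value
   0 when P is not of that kind. *)
Definition trace_on (P : set W) (T : W -> W) : F :=
  xget 0 [set t | exists n (b : 'I_n -> W) (A : 'M[F]_n),
    [/\ is_basis P b, forall i, T (b i) = \sum_j A i j *: b j & t = \tr A]].

Definition direct_sum (I : choiceType) (P : set W) (Q : I -> set W) : Prop :=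
  (forall i, Q i `<=` P) /\
  (forall w, P w -> exists! f : {fsfun I -> W with 0},
     (forall i, Q i (f i)) /\ w = \sum_(i <- finsupp f) f i).

End Subspaces.

(* [malg (K * L) F] is the tensor product of [malg K F] and [malg L F];
   [tensl T] is T (x) id and [tensr T] is id (x) T. *)
Definition tensl {K L : choiceType} (T : malg K F -> malg K F) :
    malg (K * L)%type F -> malg (K * L)%type F :=
  lext (fun k : K * L => lext (fun x => ket (x, k.2)) (T (ket k.1))).

Definition tensr {K L : choiceType} (T : malg L F -> malg L F) :
    malg (K * L)%type F -> malg (K * L)%type F :=
  lext (fun k : K * L => lext (fun x => ket (k.1, x)) (T (ket k.2))).

(* [malg {ffun I -> K} F] is the tensor product of the copies of [malg K F]
   indexed by I; [tens_at i T] is T on factor i and the identity elsewhere. *)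
Definition tens_at {I : finType} {K : choiceType} (i : I)
    (T : malg K F -> malg K F) :
    malg {ffun I -> K} F -> malg {ffun I -> K} F :=
  lext (fun f : {ffun I -> K} =>
    lext (fun x => ket [ffun j => if j == i then x else f j]) (T (ket (f i)))).

End LinearAlgebra.

(* The Heisenberg vertex algebra of F^d is the polynomial algebra on the
   variables b_i(-n), n > 0; the variable of index (i, n) is b_i(-(n+1)). *)
Notation fock_idx d := (cmonom ('I_d * nat)%type).

Section Heisenberg.
Context {F : fieldType}.

Definition fock_weight d (m : fock_idx d) : nat :=
  (\sum_(x <- finsupp m) m x * x.2.+1)%N.

Definition fock_deg d : malg (fock_idx d) F -> malg (fock_idx d) F :=
  lext (fun m => (fock_weight m)%:R *: ket m).

(* The algebra endomorphism extending b_i(-n) |-> \sum_j G i j b_j(-n). *)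
Definition fock_map d (G : 'M[F]_d) : malg (fock_idx d) F -> malg (fock_idx d) F :=
  mmap (fun a => a%:A) (fun m : fock_idx d =>
    \prod_(x <- finsupp m) (\sum_j G x.1 j *: ket (ucm (j, x.2))) ^+ m x).

End Heisenberg.

Section Clifford.
Context {F : fieldType}.

(* A(p)_tw^+ is [malg {fset nat} F]: the basis vector of index
   {n_1 > ... > n_k} is p(-(n_1+1)) ... p(-(n_k+1)) v_tw^+, and v_tw^+ is the
   one of index fset0.  The signs and the factor 2 below are those forced by
   p(m) p(n) + p(n) p(m) = 2 delta_{m+n,0} and p(0) v_tw^+ = v_tw^+. *)

Definition cliff_sign n (S : {fset nat}) : F :=
  (-1) ^+ #|` [fset s in S | (n < s)%N]|%fset.

(* The operator p(m), m in Z. *)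
Definition cliff_mode (m : int) : malg {fset nat} F -> malg {fset nat} F :=
  lext (fun S : {fset nat} => match m with
    | Posz 0 => (-1) ^+ #|` S|%fset *: ket S
    | Posz n.+1 =>
        if n \in S then (2 * cliff_sign n S) *: ket (S `\ n)%fset else 0
    | Negz n => if n \in S then 0 else cliff_sign n S *: ket (n |` S)%fset
    end).

Definition cliff_L0 (u : malg {fset nat} F) : malg {fset nat} F :=
  16%:R^-1 *: u + 2^-1 *: \sum_(n \in [set: nat])
    n.+1%:R *: cliff_mode (- n.+1%:Z) (cliff_mode n.+1%:Z u).

End Clifford.

Section TwistedProduct.
Context {F : fieldType} {M : nat}.

Local Notation Atw_idx := {ffun 'I_M -> {fset nat}}.

Definition tw_L0 (u : malg Atw_idx F) : malg Atw_idx F :=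
  \sum_(i < M) tens_at i cliff_L0 u.

Definition tw_ptilde : malg Atw_idx F -> malg Atw_idx F :=
  \big[(fun S T => S \o T)/id]_(i < M) tens_at i (cliff_mode 0).

(* Permutation of the tensor factors, factor i going to place [s i]; moving x
   past y costs the sign (-1)^(|x||y|), where |x| is the parity of the number
   of p(-n), n > 0, in x. *)
Definition tw_perm (s : 'S_M) : malg Atw_idx F -> malg Atw_idx F :=
  lext (fun f : Atw_idx =>
    (\prod_(i < M) \prod_(j < M | (i < j)%N && (s j < s i)%N)
       (-1) ^+ (#|` f i|%fset * #|` f j|%fset)) *: ket [ffun i => f ((s^-1)%g i)]).

End TwistedProduct.

Notation tw_idx d M r :=
  (fock_idx d * {ffun 'I_M -> {fset nat}} * fock_idx r)%type.

(* W_tw = V (x) A_tw (x) U, with V of rank d, M Clifford factors and U of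
   rank r. *)
Notation Wtw F d M r := (malg (tw_idx d M r) F).

Section TwistedModule.
Context {F : fieldType} {d M r : nat}.
Local Notation W := (Wtw F d M r).

Definition c1 : F := d%:R.
Definition c2 : F := M%:R / 2.
Definition c3 : F := r%:R.
Definition cc : F := c1 + c2 + c3.

Definition L1 : W -> W := tensl (tensl (@fock_deg F d)).
Definition L2 : W -> W := tensl (tensr (@tw_L0 F M)).
Definition L3 : W -> W := tensr (@fock_deg F r).
Definition L0 (w : W) : W := L1 w + L2 w + L3 w.

Definition ptilde : W -> W := tensl (tensr (@tw_ptilde F M)).
Definition gamma (G : 'M[F]_d) : W -> W := tensl (tensl (fock_map G)).
Definition sigma (s : 'S_M) : W -> W := tensl (tensr (@tw_perm F M s)).

Definition gs (G : 'M[F]_d) (s : 'S_M) : W -> W := gamma G \o sigma s.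
Definition gs_inv (G : 'M[F]_d) (s : 'S_M) : W -> W :=
  gs (invmx G) (s^-1)%g.

Definition gs_pow (G : 'M[F]_d) (s : 'S_M) (k : int) : W -> W :=
  match k with
  | Posz n => iter n (gs G s)
  | Negz n => iter n.+1 (gs_inv G s)
  end.

Definition Wn (n : nat) : set W :=
  [set w | L0 w - (cc / 24%:R) *: w = n%:R *: w].

(* The joint eigenspace W_n^{m,eps}, with (m, eps) = (x.1, (-1)^x.2). *)
Definition Wnme (n : nat) (x : int * bool) : set W :=
  [set w | [/\ Wn n w, L1 w - (c1 / 24%:R) *: w = x.1%:~R *: w
             & ptilde w = (-1) ^+ x.2 *: w]].

(* tr(g | W_n) for g = (gamma sigma)^k and W_n regarded as the virtual module
   \sum_(m, eps) eps m [W_n^{m,eps}]. *)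
Definition virtual_trace (G : 'M[F]_d) (s : 'S_M) (k : int) (n : nat) : F :=
  \sum_(x \in [set: int * bool])
    (-1) ^+ x.2 * x.1%:~R * trace_on (Wnme n x) (gs_pow G s k).

(* tr((gamma sigma)^k ptilde (L_1(0) - c_1/24) | W_n). *)
Definition weighted_trace (G : 'M[F]_d) (s : 'S_M) (k : int) (n : nat) : F :=
  trace_on (Wn n)
    (fun w => gs_pow G s k (ptilde (L1 w - (c1 / 24%:R) *: w))).

(* The gradings exhibit W_tw as a virtual graded module for Z/NZ whose
   generator acts by gamma sigma. *)
Definition virtual_graded_module (N : nat) (G : 'M[F]_d) (s : 'S_M) : Prop :=
  [/\ linear (gs G s), cancel (gs G s) (gs_inv G s),
      cancel (gs_inv G s) (gs G s) & forall w, iter N (gs G s) w = w] /\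
  [/\ direct_sum [set: W] Wn,
      forall n, findim (Wn n),
      forall n, direct_sum (Wn n) (Wnme n),
      forall n, finite_set [set x | exists2 w, Wnme n x w & w != 0]
    & forall n x, findim (Wnme n x) /\
        (forall w, Wnme n x w -> Wnme n x (gs G s w))].

End TwistedModule.

Definition ell (N : nat) : nat := `|numq ((N ^ 2 - 1)%N%:Q / 24%:Q)|%N.

Definition bigM (N : nat) : nat :=
  if N == 2 then 32 else if N == 3 then 27 else (N ^ 2)%N.

Definition rk (N : nat) : nat :=
  if N == 2 then 8 else if N == 3 then 3 else 1.

Definition has_order d (F : fieldType) (G : 'M[F]_d) (N : nat) : Prop :=
  G ^+ N = 1%:M /\ forall j, (0 < j < N)%N -> G ^+ j <> 1%:M.

(* Cycle shape N^k. *)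
Definition cycle_shape M (s : 'S_M) (N k : nat) : Prop :=
  #|porbits s| = k /\ forall X, X \in porbits s -> #|X| = N.

(* R[i] as a numClosedFieldType, the key under which mathcomp-analysis finds
   its norm topology. *)
Definition Cplx (R : realType) : numClosedFieldType := R[i].

Section Eisenstein.
Context {R : realType}.
Local Open Scope complex_scope.

Definition cexp (z : Cplx R) : Cplx R :=
  (expR (complex.Re z))%:C * (cos (complex.Im z) +i* sin (complex.Im z)).

Definition nome (tau : Cplx R) : Cplx R := cexp ((2 * pi)%:C * 'i * tau).

Definition sigma1 (n : nat) : nat := (\sum_(d <- divisors n) d)%N.

Definition E2 (tau : Cplx R) : Cplx R :=
  1 - 24%:R * limn (series (fun n => (sigma1 n.+1)%:R * nome tau ^+ n.+1)).

Definition E2N (N : nat) (tau : Cplx R) : Cplx R :=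
  ((N ^ 2)%:R * E2 (N%:R * tau) - E2 tau) / (N ^ 2 - 1)%N%:R.

(* F_g^(N)(tau), where [triv] says whether g is the identity. *)
Definition Fg (N : nat) (triv : bool) (tau : Cplx R) : Cplx R :=
  if triv then - (ell N)%:R * E2 tau else - (ell N)%:R * E2N N tau.

End Eisenstein.

(* Main.v *)
(** On each tensor factor of W_tw the basis vectors of the Fock spaces are
    eigenvectors of L_1(0), L_2(0), L_3(0) and ptilde(0), so all the graded
    pieces are spans of basis vectors and the traces are sums of diagonal
    coefficients.  The weighted trace is then a Cauchy product
    (q d/dq - ell) A * B * C, where A, B, C are the characters of
    (gamma sigma)^k on the three factors.  Removing one mode at a time gives
    each of them a recursion q dA/dq = S A with S a divisor sum: for V from the
    eigenvalues of gamma^k, read off its characteristic polynomial; for the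
    Clifford factor from the fact that the Koszul sign of a cycle of prime
    length N, multiplied by the eigenvalue of ptilde(0), is the parity of a
    single factor, so that only the configurations constant on cycles
    contribute, with q replaced by q^N.  The three S's add up to 0 and hence
    A B C = 1: the weighted trace is S_A - ell, the expansion of the Eisenstein
    series. *)

From HB Require Import structures.
Require Import Defs.
From mathcomp Require Import all_boot all_order all_fingroup all_algebra.
From mathcomp Require Import all_classical all_reals all_analysis.
From mathcomp Require Import finmap complex separable cyclotomic ring lra zify.
From mathcomp.multinomials Require Import -(notations) monalg.
Import Order.TTheory GRing.Theory Num.Theory numFieldNormedType.Exports.
Local Open Scope classical_set_scope.
Local Open Scope ring_scope.

Set Implicit Arguments.
Unset Strict Implicit.
Unset Printing Implicit Defensive.

(** * Spans of basis vectors, traces and tensor products *)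

(** No infinite product is formed: a power series with constant term 1 is determined in
    characteristic 0 by its logarithmic derivative, so identities between products of factors 1 -
    q^n become identities between divisor sums.

    The matrix of gamma is in general not diagonal in the basis [b_i], whereas the gradings are. Its
    traces on the finite levels are invariant under conjugation, so it enters only through the power
    sums of its eigenvalues; for the j-th power they equal M[N | jp] - r. Hence, when N does not
    divide j, the divisor d = n/p of n is weighted by M[N | p] - r in S_A, by -M[N | p] in S_B and
    by r in S_C: the bosons of U make up for the factor (x-1)^r, and the M fermions cancel the
    cycles.

    The constants obey M = r N^2 and M - r = 24 ell_N. The second relation gives c_1/24 = ell_N, and
    rank(V) + r = M gives c/24 = M/16. This is the ground energy of M twisted fermions, so L(0) -
    c/24 has natural numbers as eigenvalues. The first relation is what turns the divisor sums into
    E_{2,N}. *)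

Section LinearExtension.
Context {F : fieldType}.

Section OneSpace.
Context {K : choiceType}.
Implicit Types (u : malg K F) (k : K) (P : K -> Prop).

Lemma lextEw (W : lmodType F) (f : K -> W) u (D : {fset K}) :
  (msupp u `<=` D)%fset -> lext f u = \sum_(k <- D) mcoeff k u *: f k.
Proof.
move=> le; rewrite /lext (big_fset_incl _ le) //= => k _ /mcoeff_outdom ->.
by rewrite scale0r.
Qed.

Lemma lext_linear (W : lmodType F) (f : K -> W) : linear (lext f).
Proof.
move=> a u v.
pose D := (msupp u `|` msupp v)%fset.
have sub : (msupp (a *: u + v) `<=` D)%fset.
  apply: fsubset_trans (msuppD_le _ _) _.
  by apply: fsetSU; exact: msuppZ_le.
rewrite (lextEw _ sub) (lextEw _ (fsubsetUl (msupp u) (msupp v))).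
rewrite (lextEw _ (fsubsetUr (msupp u) (msupp v))) scaler_sumr -big_split /=.
by apply: eq_bigr => k _; rewrite mcoeffD mcoeffZ scalerDl scalerA.
Qed.

HB.instance Definition _ (W : lmodType F) (f : K -> W) :=
  GRing.isLinear.Build F (malg K F) W _ (lext f) (lext_linear f).

Lemma mcoeff_ket k k' : mcoeff k' (ket k : malg K F) = (k == k')%:R.
Proof. by rewrite mcoeffU. Qed.

Lemma msupp_ket k : msupp (ket k : malg K F) = [fset k]%fset.
Proof. by rewrite msuppU oner_eq0. Qed.

Lemma mkmalgUE k (c : F) : mkmalgU k c = c *: ket k.
Proof. by apply/malgP => k'; rewrite mcoeffZ !mcoeffU mulr_natr. Qed.

Lemma lext_ket (W : lmodType F) (f : K -> W) k : lext f (ket k) = f k.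
Proof. by rewrite /lext msupp_ket big_seq_fset1 mcoeff_ket eqxx scale1r. Qed.

Lemma malg_ket u : u = \sum_(k <- msupp u) mcoeff k u *: ket k.
Proof.
by rewrite {1}[u]monalgE; apply: eq_bigr => k _; rewrite mkmalgUE.
Qed.

Lemma lext_id u : lext (fun k => ket k) u = u.
Proof. by rewrite /lext -malg_ket. Qed.

Lemma linear_lext (V W : lmodType F) (T : {linear V -> W}) (f : K -> V) u :
  T (lext f u) = lext (T \o f) u.
Proof. by rewrite /lext linear_sum; apply: eq_bigr => k _; rewrite linearZ. Qed.

Lemma lextE (W : lmodType F) (T : {linear malg K F -> W}) u :
  T u = lext (fun k => T (ket k)) u.
Proof. by rewrite -[in LHS](lext_id u) linear_lext. Qed.

Lemma eq_lext (W : lmodType F) (f g : K -> W) : f =1 g -> lext f =1 lext g.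
Proof. by move=> fg u; apply: eq_bigr => k _; rewrite fg. Qed.

Lemma eq_on_kets (W : lmodType F) (S T : {linear malg K F -> W}) :
  (forall k, S (ket k) = T (ket k)) -> S =1 T.
Proof. by move=> ST u; rewrite (lextE S) (lextE T); exact: eq_lext. Qed.

Lemma mcoeff_sum (I : Type) (r : seq I) (f : I -> malg K F) k :
  mcoeff k (\sum_(i <- r) f i) = \sum_(i <- r) mcoeff k (f i).
Proof. exact: raddf_sum. Qed.

Lemma mcoeff_lext (L : choiceType) (f : L -> malg K F) (v : malg L F) k :
  mcoeff k (lext f v) = \sum_(l <- msupp v) mcoeff l v * mcoeff k (f l).
Proof. by rewrite mcoeff_sum; apply: eq_bigr => l _; rewrite mcoeffZ. Qed.

(** The coefficientwise form passes directly to sums and scalar shifts of operators, as needed for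
    [L0] and for L(0) - c/24. *)
Definition diag_op (c : K -> F) (T : malg K F -> malg K F) :=
  forall u k, mcoeff k (T u) = c k * mcoeff k u.

Lemma diag_opP (c : K -> F) (T : {linear malg K F -> malg K F}) :
  (forall k, T (ket k) = c k *: ket k) -> diag_op c T.
Proof.
move=> Tket u k; rewrite (lextE T) (eq_lext Tket) mcoeff_lext.
rewrite [in RHS](malg_ket u) mcoeff_sum mulr_sumr; apply: eq_bigr => l _.
rewrite !mcoeffZ mcoeff_ket; case: eqP => [->|_]; last by rewrite !mulr0.
by rewrite !mulr1 mulrC.
Qed.

Lemma diag_opD c T c' T' : diag_op c T -> diag_op c' T' ->
  diag_op (fun k => c k + c' k) (fun u => T u + T' u).
Proof. by move=> dT dT' u k; rewrite mcoeffD dT dT' mulrDl. Qed.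

Lemma diag_opB c T a : diag_op c T -> diag_op (fun k => c k - a) (fun u => T u - a *: u).
Proof. by move=> dT u k; rewrite mcoeffB mcoeffZ dT mulrBl. Qed.

Definition span_on (P : K -> Prop) : set (malg K F) :=
  [set u | forall k, k \in msupp u -> P k].

Lemma span_on_ket P k : span_on P (ket k) <-> P k.
Proof.
rewrite /span_on /= msupp_ket; split => [/(_ k)|Pk k']; rewrite inE.
  by apply.
by move/eqP ->.
Qed.

Lemma diag_op_eigen c T b u : diag_op c T ->
  T u = b *: u <-> span_on (fun k => c k = b) u.
Proof.
move=> dT; split=> [Tu k|uP].
  rewrite -mcoeff_neq0 => uk; apply: (mulIf uk).
  by rewrite -dT Tu mcoeffZ.
apply/malgP => k; rewrite dT mcoeffZ.
by case: (msuppP u k) => [/uP ->|_]; rewrite ?mulr0.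
Qed.

Lemma span_onD P u v : span_on P u -> span_on P v -> span_on P (u + v).
Proof.
move=> Pu Pv k /(fsubsetP (msuppD_le _ _)); rewrite inE.
by case/orP => [/Pu|/Pv].
Qed.

Lemma span_on0 P : span_on P 0.
Proof. by move=> k; rewrite msupp0 inE. Qed.

Lemma span_onZ P a u : span_on P u -> span_on P (a *: u).
Proof. by move=> Pu k /(fsubsetP (msuppZ_le _ _)) /Pu. Qed.

Lemma span_on_sum P (I : eqType) (r : seq I) (f : I -> malg K F) :
  (forall i, i \in r -> span_on P (f i)) -> span_on P (\sum_(i <- r) f i).
Proof.
move=> Pf; rewrite big_seq; elim/big_ind: _ => //.
- exact: span_on0.
- exact: span_onD.
Qed.

Lemma span_on_lext P (L : choiceType) (f : L -> malg K F) (v : malg L F) :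
  (forall l, l \in msupp v -> span_on P (f l)) -> span_on P (lext f v).
Proof. by move=> Pf; apply: span_on_sum => l lv; apply: span_onZ; exact: Pf. Qed.

Lemma sum_ket_eq0 n (E : 'I_n -> K) (a : 'I_n -> F) : injective E ->
  \sum_i a i *: ket (E i) = 0 :> malg K F -> forall i, a i = 0.
Proof.
move=> injE a0 i; have := congr1 (mcoeff (E i)) a0.
rewrite mcoeff0 raddf_sum /= (bigD1 i) //= mcoeffZ mcoeff_ket eqxx mulr1.
rewrite big1 ?addr0 // => j ji; rewrite mcoeffZ mcoeff_ket.
by rewrite (inj_eq injE) (negPf ji) mulr0.
Qed.

Lemma span_on_basis P (E : seq K) : uniq E -> (forall k, P k <-> k \in E) ->
  is_basis (span_on P) (fun i : 'I_(size E) => ket (tnth (in_tuple E) i)).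
Proof.
move=> uE PE; split=> [w|a]; last first.
  by apply: sum_ket_eq0; exact/tuple_uniqP.
split=> [Pw|[a ->]]; last first.
  apply: span_on_sum => i _; apply: span_onZ; apply/span_on_ket/PE.
  exact: mem_tnth.
exists (fun i => mcoeff (tnth (in_tuple E) i) w).
rewrite -(big_tuple _ _ (in_tuple E) xpredT (fun k => mcoeff k w *: ket k)) /=.
rewrite -[LHS]lext_id (@lextEw _ _ _ [fset k in E]%fset).
  apply: perm_big; apply: uniq_perm => //; by move=> k; rewrite inE.
by apply/fsubsetP => k kw; rewrite inE; apply/PE/Pw.
Qed.

Lemma shifted_comp_ket (W : lmodType F) (A : {linear malg K F -> W})
    (B : {linear malg K F -> malg K F}) (C : malg K F -> malg K F) (a b c : F) k :
  B (ket k) = b *: ket k -> C (ket k) = c *: ket k ->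
  A (B (C (ket k) - a *: ket k)) = ((c - a) * b) *: A (ket k).
Proof. by move=> Bk Ck; rewrite Ck -scalerBl linearZ /= Bk scalerA linearZ. Qed.

End OneSpace.

Lemma shifted_comp_linear (V : lmodType F) (A B C : {linear V -> V}) a :
  linear (fun w => A (B (C w - a *: w))).
Proof.
move=> x u v; rewrite -!linearP; congr (A (B _)); rewrite linearP scalerDr scalerBr.
by rewrite !scalerA [a * x]mulrC opprD addrACA.
Qed.

(** [trace_on] picks an unspecified basis, so independence of the choice has to be shown. The
    transition matrices [C] and [D], rectangular a priori, satisfy CD = 1, DC = 1 and CA = A'C, and
    cyclicity of the trace gives tr A' = tr A. *)
Lemma trace_onE (W : lmodType F) (P : set W) (T : {linear W -> W}) n
    (b : 'I_n -> W) (A : 'M[F]_n) :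
  is_basis P b -> (forall i, T (b i) = \sum_j A i j *: b j) ->
  trace_on P T = \tr A.
Proof.
move=> bB TA; rewrite /trace_on; apply: xget_unique; first by exists n, b, A.
move=> _ [m [b' [A' [b'B TA' ->]]]].
have comb p q (C : 'M[F]_(p, q)) (x : 'I_p -> W) (y : 'I_q -> W) r0
    (D : 'M[F]_(q, r0)) (z : 'I_r0 -> W) :
    (forall i, x i = \sum_j C i j *: y j) ->
    (forall i, y i = \sum_j D i j *: z j) ->
    forall i, x i = \sum_j (C *m D) i j *: z j.
  move=> xy yz i; rewrite xy.
  under eq_bigr do rewrite yz scaler_sumr.
  rewrite exchange_big /=; apply: eq_bigr => j _.
  by rewrite mxE scaler_suml; apply: eq_bigr => k _; rewrite scalerA.
have expand p q (x : 'I_p -> W) (y : 'I_q -> W) : is_basis P x -> is_basis P y ->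
    exists C : 'M[F]_(p, q), forall i, x i = \sum_j C i j *: y j.
  move=> [xP _] [yP _].
  have Px i : P (x i).
    apply/xP; exists (fun j => (i == j)%:R); rewrite (bigD1 i) //= eqxx scale1r.
    by rewrite big1 ?addr0 // => j /negPf ji; rewrite eq_sym ji scale0r.
  have /choice[C CP] i : exists a : 'I_q -> F, x i = \sum_j a j *: y j.
    by apply/yP.
  exists (\matrix_(i, j) C i j) => i; rewrite CP; apply: eq_bigr => j _.
  by rewrite mxE.
have indep p q (x : 'I_q -> W) (C D : 'M[F]_(p, q)) : is_basis P x ->
    (forall i, \sum_j C i j *: x j = \sum_j D i j *: x j) -> C = D.
  move=> [_ xI] CD; apply/matrixP => i j; apply/eqP; rewrite -subr_eq0; apply/eqP.
  move: j; apply: xI; under eq_bigr do rewrite scalerBl.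
  by rewrite sumrB CD subrr.
have self p (x : 'I_p -> W) i : x i = \sum_j (1%:M : 'M[F]_p) i j *: x j.
  rewrite (bigD1 i) //= mxE eqxx scale1r big1 ?addr0 // => j /negPf ji.
  by rewrite mxE eq_sym ji scale0r.
have lin p q (x : 'I_p -> W) (y : 'I_q -> W) (C : 'M[F]_(p, q)) :
    (forall i, x i = \sum_j C i j *: y j) ->
    forall i, T (x i) = \sum_j C i j *: T (y j).
  by move=> xy i; rewrite xy linear_sum; apply: eq_bigr => j _; rewrite linearZ.
have [C b'b] := expand _ _ _ _ b'B bB.
have [D bb'] := expand _ _ _ _ bB b'B.
have CD : C *m D = 1%:M.
  by apply: (indep _ _ _ _ _ b'B) => i; rewrite -(comb _ _ _ _ _ _ _ _ b'b bb') -self.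
have DC : D *m C = 1%:M.
  by apply: (indep _ _ _ _ _ bB) => i; rewrite -(comb _ _ _ _ _ _ _ _ bb' b'b) -self.
have CA : C *m A = A' *m C.
  apply: (indep _ _ _ _ _ bB) => i.
  by rewrite -(comb _ _ _ _ _ _ _ _ (lin _ _ _ _ _ b'b) TA) -(comb _ _ _ _ _ _ _ _ TA' b'b).
by rewrite -[A']mulmx1 -CD mulmxA -CA mxtrace_mulC mulmxA DC mul1mx.
Qed.

Lemma trace_on_span (K : choiceType) (P : K -> Prop) (E : seq K)
    (T : malg K F -> malg K F) :
  linear T -> uniq E -> (forall k, P k <-> k \in E) ->
  (forall k, P k -> span_on P (T (ket k))) ->
  trace_on (span_on P) T = \sum_(k <- E) mcoeff k (T (ket k)).
Proof.
move=> linT uE PE TP; pose e := tnth (in_tuple E).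
pose A : 'M[F]_(size E) := \matrix_(i, j) mcoeff (e j) (T (ket (e i))).
pose Tl : {linear malg K F -> malg K F} :=
  HB.pack T (GRing.isLinear.Build F (malg K F) (malg K F) _ T linT).
rewrite (@trace_onE _ _ Tl _ _ A (span_on_basis uE PE)).
  rewrite [RHS](big_tuple _ _ (in_tuple E) xpredT) /=.
  by apply: eq_bigr => i _; rewrite mxE.
move=> i; have [/(_ (T (ket (e i))))[+ _] _] := span_on_basis uE PE.
case=> [|a Ta]; first by apply/TP/PE; exact: mem_tnth.
apply: (etrans Ta); apply: eq_bigr => j _; rewrite mxE Ta; congr (_ *: _).
rewrite mcoeff_sum (bigD1 j) //= mcoeffZ mcoeff_ket eqxx mulr1 big1 ?addr0 //.
move=> l lj; rewrite mcoeffZ mcoeff_ket.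
have /tuple_uniqP einj : uniq (in_tuple E) by [].
by rewrite (inj_eq einj) (negPf lj) mulr0.
Qed.

Lemma findim_span (K : choiceType) (P : K -> Prop) (E : seq K) :
  uniq E -> (forall k, P k <-> k \in E) -> findim (span_on (K := K) P).
Proof. by move=> uE PE; eexists; eexists; exact: span_on_basis uE PE. Qed.

(** If n vectors spanned, the coordinates of n+1 distinct basis vectors would form an (n+1) x n
    matrix; a nonzero row vector in its kernel is a linear relation between these basis vectors. *)
Lemma infinite_not_findim (K : choiceType) (E : nat -> K) : injective E ->
  ~ findim [set: malg K F].
Proof.
move=> injE [n [b [bspan _]]].
have /choice[C CP] (i : 'I_n.+1) : exists a : 'I_n -> F, ket (E i) = \sum_j a j *: b j.
  by apply/bspan.
pose A : 'M[F]_(n.+1, n) := \matrix_(i, j) C i j.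
have /rowV0Pn[v vA v0] : kermx A != 0.
  by rewrite -mxrank_eq0 mxrank_ker subn_eq0 -ltnNge ltnS rank_leq_col.
case/negP: v0; apply/eqP/rowP => i; rewrite mxE.
apply: (sum_ket_eq0 (E := fun i : 'I_n.+1 => E i) (a := v 0)) => [x y /injE /val_inj //|].
under eq_bigr do rewrite CP scaler_sumr.
rewrite exchange_big /= big1 // => j _.
under eq_bigr do rewrite scalerA.
rewrite -scaler_suml (_ : \sum_i _ = (v *m A) 0 j); last first.
  by rewrite mxE; apply: eq_bigr => k _; rewrite mxE.
by rewrite (sub_kermxP vA) mxE scale0r.
Qed.

(* The component of index [i] of a vector is its restriction to the basis
   vectors that [h] labels by [i]. *)
Lemma direct_sum_span (K I : choiceType) (P : K -> Prop) (h : K -> I) :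
  direct_sum (span_on (K := K) P) (fun i => span_on (fun k => P k /\ h k = i)).
Proof.
split=> [i u Pu k /Pu[] //|w Pw].
pose c i : malg K F := \sum_(k <- msupp w | h k == i) mcoeff k w *: ket k.
have cE i k : mcoeff k (c i) = if h k == i then mcoeff k w else 0.
  rewrite /c big_mkcond mcoeff_sum.
  case: (msuppP w k) => [kw|kw].
    rewrite (big_fsetD1 k) //= big_seq big1 ?addr0 => [|l].
      by case: eqP => _; rewrite ?mcoeff0 // mcoeffZ mcoeff_ket eqxx mulr1.
    rewrite !inE => /andP[/negPf lk _].
    by case: eqP => _; rewrite ?mcoeff0 // mcoeffZ mcoeff_ket lk mulr0.
  rewrite if_same big_seq big1 // => l lw; case: eqP => _; rewrite ?mcoeff0 //.
  rewrite mcoeffZ mcoeff_ket; case: eqP => [lk|_]; last by rewrite mulr0.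
  by rewrite -lk lw in kw.
pose D := [fset h k | k in msupp w]%fset.
pose f : {fsfun I -> malg K F with 0} := [fsfun i in D => c i | 0].
have fE i : f i = c i.
  rewrite fsfunE; case: ifPn => // iD; apply/malgP => k; rewrite mcoeff0 cE.
  case: eqP => // hk; case: (msuppP w k) => // kw.
  by case/negP: iD; apply/imfsetP; exists k.
have sumE (g : {fsfun I -> malg K F with 0}) k :
    (forall i, span_on (fun k => P k /\ h k = i) (g i)) ->
    mcoeff k (\sum_(i <- finsupp g) g i) = mcoeff k (g (h k)).
  move=> gP; rewrite mcoeff_sum.
  have g0 i : i != h k -> mcoeff k (g i) = 0.
    by move=> ihk; apply: mcoeff_outdom; apply/negP => /gP[_ hk]; rewrite hk eqxx in ihk.
  have [hg|hg] := boolP (h k \in finsupp g).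
    rewrite (big_fsetD1 (h k)) //= big_seq big1 ?addr0 // => i.
    by rewrite !inE => /andP[/g0].
  rewrite big_seq big1 ?(fsfun_dflt hg) ?mcoeff0 // => i ig; apply: g0.
  by apply: contraNneq hg => <-.
have fP i : span_on (fun k => P k /\ h k = i) (f i).
  move=> k; rewrite fE -mcoeff_neq0 cE; case: (h k =P i) => [hk|_].
    by rewrite mcoeff_neq0 => /Pw.
  by rewrite eqxx.
exists f; split.
  split=> //; apply/malgP => k; rewrite sumE // fE cE eqxx //.
move=> g [gP wE]; apply/fsfunP => i; apply/malgP => k; rewrite fE cE.
case: eqP => [<-|hk]; first by rewrite wE sumE.
by apply/esym/mcoeff_outdom/negP => /gP[_].
Qed.

(** * Operators on tensor products *)

Section Tensor.
Context {K L : choiceType}.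
Implicit Types (S T : malg K F -> malg K F) (U V : malg L F -> malg L F).
Local Notation KL := (malg (K * L)%type F).

Lemma tensl_linear T : linear (@tensl F K L T).
Proof. exact: lext_linear. Qed.

Lemma tensr_linear U : linear (@tensr F K L U).
Proof. exact: lext_linear. Qed.

HB.instance Definition _ T :=
  GRing.isLinear.Build F KL KL _ (@tensl F K L T) (tensl_linear T).
HB.instance Definition _ U :=
  GRing.isLinear.Build F KL KL _ (@tensr F K L U) (tensr_linear U).

Lemma tensl_ket T k l : tensl T (ket (k, l)) = lext (fun x => ket (x, l) : KL) (T (ket k)).
Proof. by rewrite /tensl lext_ket. Qed.

Lemma tensr_ket U k l : tensr U (ket (k, l)) = lext (fun x => ket (k, x) : KL) (U (ket l)).
Proof. by rewrite /tensr lext_ket. Qed.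

(** [tensl] records only the values of its argument on basis vectors; linearity of [S] is what lets
    it pass through the expansion of [T (ket k)]. *)
Lemma tensl_comp (S : {linear malg K F -> malg K F}) T u :
  tensl S (tensl T u) = tensl (K := K) (L := L) (S \o T) u.
Proof.
move: u; apply: (eq_on_kets (S := tensl S \o tensl T)) => -[k l] /=.
rewrite !tensl_ket linear_lext /=.
rewrite (eq_lext (g := lext (fun x => ket (x, l) : KL) \o (S \o (fun x => ket x)))).
  by rewrite -linear_lext -linear_lext lext_id.
by move=> x; rewrite /= tensl_ket.
Qed.

Lemma tensr_comp (U : {linear malg L F -> malg L F}) V u :
  tensr U (tensr V u) = tensr (K := K) (L := L) (U \o V) u.
Proof.
move: u; apply: (eq_on_kets (S := tensr U \o tensr V)) => -[k l] /=.
rewrite !tensr_ket linear_lext /=.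
rewrite (eq_lext (g := lext (fun x => ket (k, x) : KL) \o (U \o (fun x => ket x)))).
  by rewrite -linear_lext -linear_lext lext_id.
by move=> x; rewrite /= tensr_ket.
Qed.

Lemma tenslr_comm T U u :
  tensl T (tensr U u) = tensr U (tensl T u) :> KL.
Proof.
move: u; apply: (eq_on_kets (S := tensl T \o tensr U) (T := tensr U \o tensl T)).
move=> -[k l] /=; rewrite tensl_ket tensr_ket !linear_lext /=.
under eq_lext do rewrite /= tensl_ket.
under [RHS]eq_lext do rewrite /= tensr_ket.
set v := U _; set u := T _.
change (\sum_(y <- msupp v) mcoeff y v *:
          \sum_(x <- msupp u) mcoeff x u *: (ket (x, y) : KL) =
        \sum_(x <- msupp u) mcoeff x u *:
          \sum_(y <- msupp v) mcoeff y v *: (ket (x, y) : KL)).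
under eq_bigr do rewrite scaler_sumr.
under [RHS]eq_bigr do rewrite scaler_sumr.
rewrite exchange_big /=; apply: eq_bigr => i _; apply: eq_bigr => j _.
by rewrite !scalerA mulrC.
Qed.

Lemma eq_tensl S T : S =1 T -> tensl (L := L) S =1 tensl T.
Proof. by move=> ST; apply: eq_lext => k; rewrite ST. Qed.

Lemma eq_tensr U V : U =1 V -> tensr (K := K) U =1 tensr V.
Proof. by move=> UV; apply: eq_lext => k; rewrite UV. Qed.

Lemma tensl_id u : tensl id u = u :> KL.
Proof. by rewrite -[RHS]lext_id; apply: eq_lext => -[k l]; rewrite /= lext_ket. Qed.

Lemma tensr_id u : tensr id u = u :> KL.
Proof. by rewrite -[RHS]lext_id; apply: eq_lext => -[k l]; rewrite /= lext_ket. Qed.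

Lemma tensl_diag c T : (forall k, T (ket k) = c k *: ket k) ->
  forall k, tensl T (ket k) = c k.1 *: ket k :> KL.
Proof. by move=> dT [k l]; rewrite tensl_ket dT linearZ /= lext_ket. Qed.

Lemma tensr_diag c U : (forall l, U (ket l) = c l *: ket l) ->
  forall k, tensr U (ket k) = c k.2 *: ket k :> KL.
Proof. by move=> dU [k l]; rewrite tensr_ket dU linearZ /= lext_ket. Qed.

Lemma mcoeff_lext_pairl (u : malg K F) l k l' :
  mcoeff (k, l') (lext (fun x => ket (x, l) : KL) u) = (l == l')%:R * mcoeff k u.
Proof.
rewrite {2}[u]malg_ket mcoeff_lext mcoeff_sum mulr_sumr; apply: eq_bigr => x _.
rewrite mcoeffZ !mcoeff_ket xpair_eqE -mulnb natrM; ring.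
Qed.

Lemma eq_tensl_id T : T =1 id -> tensl T =1 (id : KL -> KL).
Proof. by move=> T1 u; rewrite (eq_tensl T1) tensl_id. Qed.

End Tensor.

Section TripleTensor.
Context {K1 K2 K3 : choiceType}.
Local Notation W := (malg (K1 * K2 * K3)%type F).
Implicit Types (T : {linear malg K1 F -> malg K1 F}) (S : {linear malg K2 F -> malg K2 F}).

(** [gs G s] is convertible to [tens12 (fock_map G) (tw_perm s)], so that composition and trace of
    gamma sigma can be studied for abstract factors. *)
Definition tens12 (T : malg K1 F -> malg K1 F) (S : malg K2 F -> malg K2 F) (w : W) : W :=
  tensl (tensl T) (tensl (tensr S) w).

Lemma tens12_linear T S : linear (tens12 T S).
Proof. by move=> a u v; rewrite /tens12 !linearP. Qed.

Lemma eq_tens12 (T T' : malg K1 F -> malg K1 F) (S S' : malg K2 F -> malg K2 F) :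
  T =1 T' -> S =1 S' -> tens12 T S =1 tens12 T' S'.
Proof.
move=> TT SS w.
apply: etrans (congr1 (tensl (tensl T)) (eq_tensl (eq_tensr SS) w)) _.
exact: (eq_tensl (eq_tensl TT) (tensl (tensr S') w)).
Qed.

Lemma tens12_id w : tens12 id id w = w.
Proof.
apply: etrans (congr1 (tensl (tensl id)) (eq_tensl_id (@tensr_id K1 K2) w)) _.
exact: (eq_tensl_id (@tensl_id K1 K2)).
Qed.

Lemma tens12_comp T S (T' : malg K1 F -> malg K1 F) (S' : malg K2 F -> malg K2 F) w :
  tens12 T S (tens12 T' S' w) = tens12 (T \o T') (S \o S') w.
Proof.
have comm v : tensl (tensr S) (tensl (tensl T') v) = tensl (tensl T') (tensl (tensr S) v) :> W.
  apply: etrans (@tensl_comp _ K3 (tensr S) (tensl T') v) _.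
  apply: etrans (esym (@tensl_comp _ K3 (tensl T') (tensr S) v)).
  by apply: eq_tensl => u; exact: (esym (tenslr_comm T' S u)).
have compT v : tensl (tensl T) (tensl (tensl T') v) = tensl (tensl (T \o T')) v :> W.
  apply: etrans (@tensl_comp _ K3 (tensl T) (tensl T') v) _.
  by apply: eq_tensl => u; exact: (@tensl_comp K1 K2 T T' u).
have compS v : tensl (tensr S) (tensl (tensr S') v) = tensl (tensr (S \o S')) v :> W.
  apply: etrans (@tensl_comp _ K3 (tensr S) (tensr S') v) _.
  by apply: eq_tensl => u; exact: (@tensr_comp K1 K2 S S' u).
apply: (etrans (congr1 (tensl (tensl T)) (comm (tensl (tensr S') w)))).
apply: (etrans (compT (tensl (tensr S) (tensl (tensr S') w)))).
exact: (congr1 (tensl (tensl (T \o T'))) (compS w)).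
Qed.

Lemma tens12_ket T S k f f' l a : S (ket f) = a *: ket f' ->
  tens12 T S (ket (k, f, l)) = a *: lext (fun x => ket (x, f', l) : W) (T (ket k)).
Proof.
move=> Sf; rewrite /tens12 tensl_ket tensr_ket Sf linearZ /= lext_ket.
rewrite linearZ /= lext_ket linearZ /=; congr (_ *: _).
by rewrite !tensl_ket linear_lext; apply: eq_lext => x; rewrite /= lext_ket.
Qed.

Lemma mcoeff_lext_triple (u : malg K1 F) f l k f' l' :
  mcoeff (k, f', l') (lext (fun x => ket (x, f, l) : W) u) =
  (f == f')%:R * (l == l')%:R * mcoeff k u.
Proof.
have -> : lext (fun x => ket (x, f, l) : W) u =
    lext (fun y => ket (y, l) : W) (lext (fun x => ket (x, f)) u).
  by rewrite linear_lext; apply: eq_lext => x; rewrite /= lext_ket.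
by rewrite !mcoeff_lext_pairl; ring.
Qed.

End TripleTensor.

Section TensorPower.
Context {I : finType} {K : choiceType}.
Local Notation KI := (malg {ffun I -> K} F).

Lemma tens_at_linear i (T : malg K F -> malg K F) : linear (tens_at i T : KI -> KI).
Proof. exact: lext_linear. Qed.

HB.instance Definition _ i T :=
  GRing.isLinear.Build F KI KI _ (@tens_at F I K i T) (tens_at_linear i T).

Lemma tens_at_diag i c (T : malg K F -> malg K F) :
  (forall k, T (ket k) = c k *: ket k) ->
  forall f, tens_at i T (ket f) = c (f i) *: ket f :> KI.
Proof.
move=> dT f; rewrite /tens_at lext_ket dT linearZ /= lext_ket.
by congr (_ *: ket _); apply/ffunP => j; rewrite ffunE; case: eqP => [->|].
Qed.

End TensorPower.
End LinearExtension.

(** * Heisenberg Fock spaces *)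

Section GradedBasis.

Definition locally_finite (K : choiceType) (wt : K -> nat) : Prop :=
  forall n, finite_set [set k | wt k = n].

(** [fset_set] has a default value on infinite sets, so this is meaningful only for a
    [locally_finite] weight. *)
Definition level (K : choiceType) (wt : K -> nat) n : {fset K} :=
  fset_set [set k | wt k = n].

Lemma mem_level (K : choiceType) (wt : K -> nat) n k :
  locally_finite wt -> (k \in level wt n) = (wt k == n).
Proof.
by move=> fin; rewrite /level in_fset_set //; apply/idP/eqP; rewrite in_setE.
Qed.

Definition wt_pair (K L : choiceType) (wK : K -> nat) (wL : L -> nat) (x : K * L) :=
  (wK x.1 + wL x.2)%N.

Lemma locally_finite_pair (K L : choiceType) (wK : K -> nat) (wL : L -> nat) :
  locally_finite wK -> locally_finite wL -> locally_finite (wt_pair wK wL).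
Proof.
move=> fK fL n.
pose A := \bigcup_(i in `I_n.+1) ([set k | wK k = i] `*` [set l | wL l = (n - i)%N]).
apply: (sub_finite_set (B := A)) => [[k l] /= kl|].
  exists (wK k); rewrite /= /wt_pair /= in kl *; first by rewrite ltnS -kl leq_addr.
  by split=> //=; rewrite -kl addKn.
by apply: bigcup_finite => // i _; apply: finite_setX.
Qed.

(** Weights add on pairs; this is the source of the Cauchy products of characters. *)
Lemma big_level_pair (F : nmodType) (K L : choiceType) (wK : K -> nat)
    (wL : L -> nat) n (f : K * L -> F) :
  locally_finite wK -> locally_finite wL ->
  \sum_(x <- level (wt_pair wK wL) n) f x =
  \sum_(i < n.+1) \sum_(k <- level wK i) \sum_(l <- level wL (n - i)) f (k, l).
Proof.
move=> fK fL; pose g := fun i : 'I_n.+1 =>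
  [seq (k, l) | k <- level wK i, l <- level wL (n - i)].
transitivity (\sum_(x <- flatten [seq g i | i <- index_enum 'I_n.+1]) f x); last first.
  rewrite big_flatten big_map; apply: eq_bigr => i _.
  by rewrite /g big_allpairs.
apply: perm_big; apply: uniq_perm => // [|[k l]].
  have: uniq (index_enum 'I_n.+1) by exact: index_enum_uniq.
  elim: (index_enum _) => //= i s IHs /andP[iN us].
  rewrite cat_uniq IHs // andbT; apply/andP; split.
    by rewrite allpairs_uniq // => -[? ?] [? ?].
  apply/hasPn => -[k l] /flatten_mapP[j js /allpairsP[[k' l']]].
  rewrite /= !mem_level // => -[/eqP kj _ [kk _]]; subst k'.
  apply/negP => /allpairsP[[k' l2]]; rewrite /= !mem_level // => -[/eqP ki _ [kk _]].
  subst k'; suff ij : i = j by rewrite ij js in iN.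
  by apply: val_inj; rewrite /= -ki -kj.
rewrite mem_level; last exact: locally_finite_pair.
apply/eqP/flatten_mapP => [kl|[i _ /allpairsP[[k' l']]]]; last first.
  rewrite /= !mem_level // => -[/eqP ki /eqP li [-> ->]].
  by rewrite /wt_pair /= ki li subnKC // -ltnS.
have kn : (wK k < n.+1)%N by rewrite ltnS -kl leq_addr.
exists (Ordinal kn); first exact: mem_index_enum.
apply/allpairsP; exists (k, l); rewrite /= !mem_level // eqxx; split=> //.
by rewrite -kl /wt_pair /= addKn.
Qed.

End GradedBasis.

Lemma prod_exprZ (F : comNzRingType) (B : comAlgType F) (I : Type) (r : seq I)
    (c : I -> F) (u v : I -> B) (n : I -> nat) :
  (forall i, v i = c i *: u i) ->
  \prod_(i <- r) v i ^+ n i =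
  (\prod_(i <- r) c i ^+ n i) *: \prod_(i <- r) u i ^+ n i.
Proof. by move=> vE; rewrite -scaler_prod; apply: eq_bigr => i _; rewrite vE exprZn. Qed.

Lemma prod_morph_pow (K : conomType) (B : comNzRingType) (f : K -> B) (I : Type)
    (r : seq I) (u : I -> K) (n : I -> nat) :
  f mone = 1 -> {morph f : x y / mmul x y >-> x * y} ->
  \prod_(i <- r) f (u i) ^+ n i =
  f (\big[mmul/mone]_(i <- r) iter (n i) (mmul (u i)) mone).
Proof.
move=> f1 fM; rewrite (big_morph f fM f1); apply: eq_bigr => i _.
by elim: (n i) => [|k IHk] //=; rewrite fM exprS IHk.
Qed.

(** tr(ST) = tr(TS) on the span of [E]: stability ensures that the intermediate index of the matrix
    product also stays in [E]. *)
Lemma sum_diag_comm (F : fieldType) (K : choiceType) (E : {fset K})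
    (S T : {linear malg K F -> malg K F}) :
  (forall k, k \in E -> span_on (fun l => l \in E) (S (ket k))) ->
  (forall k, k \in E -> span_on (fun l => l \in E) (T (ket k))) ->
  \sum_(k <- E) mcoeff k (S (T (ket k))) = \sum_(k <- E) mcoeff k (T (S (ket k))).
Proof.
have expand (A B : {linear malg K F -> malg K F}) k :
    span_on (fun l => l \in E) (B (ket k)) ->
    mcoeff k (A (B (ket k))) =
    \sum_(l <- E) mcoeff l (B (ket k)) * mcoeff k (A (ket l)).
  move=> BE; rewrite (lextE A) (@lextEw _ _ _ _ _ E); last exact/fsubsetP.
  by rewrite mcoeff_sum; apply: eq_bigr => l _; rewrite mcoeffZ.
move=> SE TE; rewrite big_seq [RHS]big_seq.
under eq_bigr => k kE do rewrite (expand _ _ _ (TE _ kE)).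
under [RHS]eq_bigr => k kE do rewrite (expand _ _ _ (SE _ kE)).
rewrite -!big_seq exchange_big /=; apply: eq_bigr => k _; apply: eq_bigr => l _.
by rewrite mulrC.
Qed.

(** * The action of a matrix on a Fock space *)

Section Fock.
Context {F : fieldType} {d : nat}.
Local Notation A := (malg (fock_idx d) F).
Implicit Types (G H P : 'M[F]_d) (m : fock_idx d) (x : 'I_d * nat).

Definition fock_gen G x : A := \sum_j G x.1 j *: ket (ucm (j, x.2)).
Definition fock_mono G m : A := \prod_(x <- finsupp m) fock_gen G x ^+ m x.

Lemma fock_mapE G u : fock_map G u = lext (fock_mono G) u.
Proof.
by rewrite /fock_map /mmap /lext; apply: eq_bigr => m _; rewrite mulr_algl.
Qed.

Lemma fock_map_linear G : linear (fock_map G).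
Proof. by move=> a u v; rewrite !fock_mapE linearP. Qed.

HB.instance Definition _ G := GRing.isLinear.Build F A A _ (fock_map G) (fock_map_linear G).

Lemma fock_map_ket G m : fock_map G (ket m) = fock_mono G m.
Proof. by rewrite fock_mapE lext_ket. Qed.

Lemma big_finsuppw (R : Type) (idx : R) (op : Monoid.com_law idx) m
    (D : {fset 'I_d * nat}) (f : 'I_d * nat -> nat -> R) :
  (finsupp m `<=` D)%fset -> (forall x, f x 0%N = idx) ->
  \big[op/idx]_(x <- finsupp m) f x (m x) = \big[op/idx]_(x <- D) f x (m x).
Proof.
by move=> sub f0; apply: big_fset_incl => // x _ xm; rewrite fsfun_dflt.
Qed.

Lemma big_cmonomM (R : Type) (idx : R) (op : Monoid.com_law idx) m1 m2
    (f : 'I_d * nat -> nat -> R) :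
  (forall x, f x 0%N = idx) ->
  (forall x p q, f x (p + q)%N = op (f x p) (f x q)) ->
  \big[op/idx]_(x <- finsupp (mmul m1 m2)) f x (mmul m1 m2 x) =
  op (\big[op/idx]_(x <- finsupp m1) f x (m1 x))
     (\big[op/idx]_(x <- finsupp m2) f x (m2 x)).
Proof.
move=> f0 fD; pose D := (finsupp m1 `|` finsupp m2)%fset.
rewrite (@big_finsuppw _ _ _ (mmul m1 m2) D) //; last by rewrite mdomD.
rewrite (@big_finsuppw _ _ _ m1 D) ?fsubsetUl // (@big_finsuppw _ _ _ m2 D) ?fsubsetUr //.
by rewrite -big_split /=; apply: eq_bigr => x _; rewrite cmM fD.
Qed.

Lemma fock_monoM G m1 m2 : fock_mono G (mmul m1 m2) = fock_mono G m1 * fock_mono G m2.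
Proof.
rewrite /fock_mono (@big_cmonomM _ _ _ m1 m2 (fun x n => fock_gen G x ^+ n)) //.
by move=> x p q; rewrite exprD.
Qed.

Lemma fock_mapM G : {morph fock_map G : u v / u * v >-> u * v}.
Proof.
move=> u v; rewrite malgME linear_sum /= (fock_mapE _ u) (fock_mapE _ v) /lext mulr_suml.
apply: eq_bigr => m1 _; rewrite linear_sum /= mulr_sumr; apply: eq_bigr => m2 _.
by rewrite mkmalgUE linearZ /= fock_map_ket fock_monoM -scalerAl -scalerAr scalerA.
Qed.

Lemma ket1 : ket mone = 1 :> A. Proof. by []. Qed.

Lemma fock_map1 G : fock_map G 1 = 1.
Proof. by rewrite -ket1 fock_map_ket /fock_mono mdom1 big_seq_fset0. Qed.

Lemma fock_mapX G n : {morph fock_map G : u / u ^+ n}.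
Proof.
move=> u; elim: n => [|n IHn]; first by rewrite !expr0 fock_map1.
by rewrite !exprS fock_mapM IHn.
Qed.

Lemma fock_map_gen G H x : fock_map G (fock_gen H x) = fock_gen (H *m G) x.
Proof.
rewrite /fock_gen linear_sum /=.
under eq_bigr => j _ do rewrite linearZ /= fock_map_ket /fock_mono mdomU
  big_seq_fset1 cmUU expr1 /fock_gen scaler_sumr.
rewrite exchange_big /=; apply: eq_bigr => k _.
by rewrite mxE scaler_suml; apply: eq_bigr => j _; rewrite scalerA.
Qed.

(** The order is reversed because the image of [b_i] is read off the i-th row: matrices act on the
    right of row vectors. *)
Lemma fock_map_comp G H u : fock_map G (fock_map H u) = fock_map (H *m G) u.
Proof.
move: u; apply: (eq_on_kets (S := fock_map G \o fock_map H)) => m /=.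
rewrite !fock_map_ket /fock_mono (big_morph _ (fock_mapM G) (fock_map1 G)).
by apply: eq_bigr => x _; rewrite fock_mapX fock_map_gen.
Qed.

Lemma ketM m1 m2 : ket (mmul m1 m2) = ket m1 * ket m2 :> A.
Proof. by rewrite malgM_def fgmulUU mulr1. Qed.

Lemma prod_ket_ucm m : \prod_(x <- finsupp m) ket (ucm x) ^+ m x = ket m :> A.
Proof.
apply: etrans (@prod_morph_pow _ A (fun m => ket m) _ _ _ _ ket1 ketM) _.
apply: (congr1 (fun m : fock_idx d => ket m : A)).
pose e x n := iter n (mmul (ucm x)) mone : fock_idx d.
have eE x n y : e x n y = (n * (x == y))%N.
  by elim: n => [|n IHn]; rewrite ?cm1 //= cmM IHn cmU mulSn.
apply/eqP/cmP => y; rewrite (big_morph (fun m : fock_idx d => m y) (cmM y) (cm1 y)).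
rewrite (eq_bigr (fun x => m x * (x == y))%N) => [|x _]; last exact: eE.
have [ym|ym] := boolP (y \in finsupp m).
  rewrite (big_fsetD1 y) //= eqxx muln1 big_seq big1 ?addn0 // => x.
  by rewrite !inE => /andP[/negPf -> _]; rewrite muln0.
rewrite (fsfun_dflt ym) big_seq big1 // => x xm; case: eqP => [xy|]; rewrite ?muln0 //.
by rewrite -xy xm in ym.
Qed.

Definition fock_char (lam : 'I_d -> F) m : F := \prod_(x <- finsupp m) lam x.1 ^+ m x.

Lemma fock_map_diag (lam : 'rV[F]_d) m :
  fock_map (diag_mx lam) (ket m) = fock_char (lam 0) m *: ket m.
Proof.
rewrite fock_map_ket /fock_mono /fock_char -[in RHS]prod_ket_ucm.
have genE x : fock_gen (diag_mx lam) x = lam 0 x.1 *: ket (ucm x).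
  rewrite /fock_gen (bigD1 x.1) //= mxE eqxx mulr1n -surjective_pairing.
  by rewrite big1 ?addr0 // => j /negPf jx; rewrite mxE eq_sym jx scale0r.
exact: prod_exprZ genE.
Qed.

Lemma fock_map_id (u : A) : fock_map 1%:M u = u.
Proof.
move: u; apply: (eq_on_kets (S := fock_map 1%:M) (T := idfun)) => m /=.
rewrite -diag_const_mx fock_map_diag /fock_char big1 ?scale1r // => x _.
by rewrite mxE expr1n.
Qed.

Lemma fock_weightM m1 m2 :
  fock_weight (mmul m1 m2) = (fock_weight m1 + fock_weight m2)%N.
Proof.
rewrite /fock_weight (@big_cmonomM _ _ _ m1 m2 (fun x n => (n * x.2.+1)%N)) //.
by move=> x p q; rewrite mulnDl.
Qed.

Lemma fock_weight1 : fock_weight (mone : fock_idx d) = 0%N.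
Proof. by rewrite /fock_weight mdom1 big_seq_fset0. Qed.

Lemma fock_weightU x : fock_weight (ucm x) = x.2.+1.
Proof. by rewrite /fock_weight mdomU big_seq_fset1 cmUU mul1n. Qed.

Lemma fock_weight_ge m x : (m x * x.2.+1 <= fock_weight m)%N.
Proof.
have [xm|xm] := boolP (x \in finsupp m); last by rewrite (fsfun_dflt xm).
by rewrite /fock_weight (big_fsetD1 x) //= leq_addr.
Qed.

Lemma fock_mono_homog G m :
  span_on (fun m' => fock_weight m' = fock_weight m) (fock_mono G m).
Proof.
have homM n1 n2 (u v : A) : span_on (fun m' => fock_weight m' = n1) u ->
    span_on (fun m' => fock_weight m' = n2) v ->
    span_on (fun m' => fock_weight m' = n1 + n2)%N (u * v).
  by move=> uP vP _ /msuppM_le[m1 [m2 [/uP <- /vP <- ->]]]; rewrite fock_weightM.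
have hom1 : span_on (fun m' => fock_weight m' = 0%N) (1 : A).
  by rewrite -ket1; apply/span_on_ket; exact: fock_weight1.
change (span_on (fun m' => fock_weight m' =
  \sum_(x <- finsupp m) m x * x.2.+1)%N (fock_mono G m)).
apply: (big_ind2 (fun n u => span_on (fun m' => fock_weight m' = n) u)) => //.
  by move=> n1 u n2 v; exact: homM.
move=> x _.
have homg : span_on (fun m' => fock_weight m' = x.2.+1) (fock_gen G x).
  apply: span_on_sum => j _; apply: span_onZ.
  by apply/span_on_ket; rewrite fock_weightU.
by elim: (m x) => [|n IHn]; rewrite ?expr0 // exprS mulSn; apply: homM.
Qed.

(** A monomial of weight n only involves modes of degree at most n. This gives an index set common
    to the whole level, so that sums over modes and over monomials can be exchanged. *)
Lemma fock_weightE n m : fock_weight m = n ->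
  fock_weight m = (\sum_(i < d) \sum_(l < n) m (i, nat_of_ord l) * l.+1)%N.
Proof.
move=> mn; pose s := [seq (i, l) | i <- index_enum 'I_d, l <- index_iota 0 n].
have us : uniq s.
  by rewrite allpairs_uniq ?index_enum_uniq ?iota_uniq // => -[? ?] [? ?].
rewrite {1}/fock_weight.
rewrite (@big_finsuppw _ _ _ m [fset x in s]%fset (fun x k => k * x.2.+1)%N) //.
  rewrite (perm_big s) /=; last first.
    by apply: uniq_perm => [||x]; rewrite ?fset_uniq // inE.
  by rewrite big_allpairs; apply: eq_bigr => i _; rewrite big_mkord.
apply/fsubsetP => -[i l]; rewrite -cmE_neq0 !inE => mx.
apply/allpairsP; exists (i, l); rewrite mem_index_enum; split=> //=.
rewrite mem_index_iota -mn (leq_trans _ (fock_weight_ge _ (i, l))) //=.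
by rewrite leq_pmull // lt0n.
Qed.

(** A monomial of weight n is determined by its exponents, each at most n, on the finitely many
    modes of degree at most n. *)
Lemma fock_locally_finite : locally_finite (@fock_weight d).
Proof.
move=> n; pose e x k := iter k (mmul (ucm x)) mone : fock_idx d.
have eE x k y : e x k y = (k * (x == y))%N.
  by elim: k => [|k IHk]; rewrite ?cm1 //= cmM IHk cmU mulSn.
pose h (g : {ffun 'I_d * 'I_n -> 'I_n.+1}) : fock_idx d :=
  \big[mmul/mone]_y e (y.1, nat_of_ord y.2) (g y).
apply: (sub_finite_set (B := [set h g | g in [set: {ffun 'I_d * 'I_n -> 'I_n.+1}]])).
  move=> m /= mn; exists [ffun y => inord (m (y.1, nat_of_ord y.2))] => //.
  apply/eqP/cmP => -[i l].
  rewrite /h (big_morph (fun m : fock_idx d => m (i, l)) (cmM (i, l)) (cm1 (i, l))).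
  have [ln|nl] := ltnP l n.
    rewrite (bigD1 (i, Ordinal ln)) //= eE eqxx muln1 ffunE /= inordK; last first.
      rewrite ltnS -mn (leq_trans _ (fock_weight_ge m (i, l))) //=.
      by rewrite leq_pmulr.
    rewrite big1 ?addn0 // => -[j k] jk; rewrite eE /=; case: eqP; rewrite ?muln0 //.
    by case=> ji kl; case/eqP: jk; congr pair => //; apply: val_inj.
  rewrite big1 => [|[j k] _].
    have := fock_weight_ge m (i, l); rewrite mn /= => mnl.
    by case: (m (i, l)) mnl => // k; rewrite mulSn => ?; lia.
  rewrite eE /=; case: eqP; rewrite ?muln0 // => -[_ kl].
  by have := ltn_ord k; rewrite kl ltnNge nl.
exact: finite_image.
Qed.

(** [fock_map] is an antihomomorphism preserving each level, so by cyclicity of the trace there P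
    can be moved around until it cancels its inverse; what remains is diagonal on monomials. *)
Lemma fock_trace_similar G P (lam : 'rV[F]_d) n : P \in unitmx ->
  G = invmx P *m diag_mx lam *m P ->
  \sum_(m <- level (@fock_weight d) n) mcoeff m (fock_map G (ket m)) =
  \sum_(m <- level (@fock_weight d) n) fock_char (lam 0) m.
Proof.
move=> uP ->; have stab H m : m \in level (@fock_weight d) n ->
    span_on (fun l => l \in level (@fock_weight d) n) (fock_map H (ket m)).
  rewrite mem_level; last exact: fock_locally_finite.
  move=> /eqP mn; rewrite fock_map_ket => m' /fock_mono_homog m'm.
  by rewrite mem_level ?m'm ?mn //; exact: fock_locally_finite.
transitivity (\sum_(m <- level (@fock_weight d) n)
    mcoeff m (fock_map P (fock_map (invmx P *m diag_mx lam) (ket m)))).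
  by apply: eq_bigr => m _; rewrite fock_map_comp.
rewrite sum_diag_comm; [|exact: stab|exact: stab].
apply: eq_bigr => m _ /=; rewrite fock_map_comp mulmxA mulmxV // mul1mx.
by rewrite fock_map_diag mcoeffZ mcoeff_ket eqxx mulr1.
Qed.

Section Modes.
Variable lam : 'I_d -> F.

(** The coefficients of the product of (1 - lam_i q^l)^-1 over i and l > 0. In [fock_mode_sum] the
    factor [m (i, l)] is the eigenvalue of the number operator of one mode; with it, removing one
    quantum from that mode yields a closed recursion. *)
Definition fock_sum n : F := \sum_(m <- level (@fock_weight d) n) fock_char lam m.
Definition fock_mode_sum (i : 'I_d) (l n : nat) : F :=
  \sum_(m <- level (@fock_weight d) n) (m (i, l))%:R * fock_char lam m.

Lemma fock_charM m1 m2 : fock_char lam (mmul m1 m2) = fock_char lam m1 * fock_char lam m2.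
Proof.
rewrite /fock_char (@big_cmonomM _ _ _ m1 m2 (fun x n => lam x.1 ^+ n)) //.
by move=> x p q; rewrite exprD.
Qed.

Lemma fock_charU x : fock_char lam (ucm x) = lam x.1.
Proof. by rewrite /fock_char mdomU big_seq_fset1 cmUU expr1. Qed.

(** The degree operator is the sum over the modes of l+1 times the number operator. *)
Lemma fock_sum_modes n :
  n%:R * fock_sum n = \sum_(i < d) \sum_(l < n) l.+1%:R * fock_mode_sum i l n.
Proof.
rewrite /fock_sum mulr_sumr; transitivity (\sum_(m <- level (@fock_weight d) n)
    \sum_(i < d) \sum_(l < n) l.+1%:R * ((m (i, nat_of_ord l))%:R * fock_char lam m));
  last first.
  rewrite exchange_big; apply: eq_bigr => i _.
  by rewrite exchange_big; apply: eq_bigr => l _; rewrite -mulr_sumr.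
rewrite big_seq [RHS]big_seq; apply: eq_bigr => m.
rewrite mem_level; last exact: fock_locally_finite.
move=> /eqP mn; rewrite -{1}mn (fock_weightE mn) natr_sum mulr_suml.
apply: eq_bigr => i _; rewrite natr_sum mulr_suml; apply: eq_bigr => l _.
by rewrite natrM; ring.
Qed.

(** Only monomials containing the mode contribute, and dividing by it once is a bijection from them
    onto the monomials of weight n - (l+1). The exponent drops by one and the character by the
    factor [lam i]: the exponent m x = m' x + 1 gives the two terms. *)
Lemma fock_mode_sum_rec i l n : fock_mode_sum i l n =
  if (n < l.+1)%N then 0
  else lam i * fock_sum (n - l.+1) + lam i * fock_mode_sum i l (n - l.+1).
Proof.
have fin := @fock_locally_finite.
pose x : 'I_d * nat := (i, l); rewrite {1}/fock_mode_sum -/x.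
case: ltnP => ln.
  rewrite big_seq big1 // => m; rewrite mem_level // => /eqP mn.
  have := fock_weight_ge m x; rewrite mn /= => mxn.
  suff -> : m x = 0%N by rewrite mul0r.
  by case: (m x) mxn => // k; rewrite mulSn => ?; lia.
pose E := [fset mmul (ucm x) m | m in level (@fock_weight d) (n - l.+1)]%fset.
have EE m : (m \in E) = (m \in level (@fock_weight d) n) && (m x != 0%N).
  rewrite mem_level //; apply/imfsetP/andP => /= [[m' + ->]|[/eqP mn mx]].
    rewrite mem_level // fock_weightM fock_weightU /= => /eqP ->.
    by rewrite subnKC // eqxx cmM cmUU.
  have mE : m = mmul (ucm x) (divcm m (ucm x)).
    apply/eqP/cmP => y; rewrite cmM divcmE cmU; case: eqP => [<-|_] /=.
      by rewrite subnKC // lt0n.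
    by rewrite subn0.
  exists (divcm m (ucm x)) => //; rewrite mem_level //.
  by rewrite -mn {2}mE fock_weightM fock_weightU addKn.
transitivity (\sum_(m <- E) (m x)%:R * fock_char lam m).
  rewrite (big_fsetID _ (fun m : fock_idx d => m x != 0%N)) /=.
  rewrite [X in _ + X]big_seq [X in _ + X]big1 ?addr0; last first.
    by move=> m; rewrite !inE /= negbK => /andP[_ /eqP ->]; rewrite mul0r.
  apply: perm_big; apply: uniq_perm => [||m]; rewrite ?fset_uniq // EE.
  by rewrite !inE.
rewrite big_imfset /=; last first.
  move=> m1 m2 _ _ /eqP/cmP m12; apply/eqP/cmP => y.
  by have := m12 y; rewrite !cmM => /addnI.
rewrite -mulrDr -big_split /= mulr_sumr; apply: eq_bigr => m _.
by rewrite fock_charM fock_charU cmM cmUU natrD /=; ring.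
Qed.

End Modes.
End Fock.

(** * Logarithmic derivatives of power series *)

Section Convolution.
Context {F : comNzRingType}.
Implicit Types a b c s t : nat -> F.

Definition cauchyp a b n : F := \sum_(i < n.+1) a i * b (n - i)%N.

Lemma eq_cauchyp a b c e : a =1 b -> c =1 e -> cauchyp a c =1 cauchyp b e.
Proof. by move=> ab ce n; apply: eq_bigr => i _; rewrite ab ce. Qed.

(** Up to degree n the Cauchy product is a product of truncated polynomials, from which it inherits
    commutativity and associativity. *)
Lemma cauchyp_poly a b n k : (k <= n)%N ->
  cauchyp a b k = (\poly_(i < n.+1) a i * \poly_(i < n.+1) b i)`_k.
Proof.
move=> kn; rewrite coefM; apply: eq_bigr => i _; rewrite !coef_poly.
by rewrite (leq_trans (ltn_ord i)) ?ltnS // (leq_trans (leq_subr _ _) kn).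
Qed.

Lemma cauchypC a b n : cauchyp a b n = cauchyp b a n.
Proof. by rewrite !(cauchyp_poly _ _ (leqnn n)) mulrC. Qed.

Lemma cauchypA a b c n : cauchyp a (cauchyp b c) n = cauchyp (cauchyp a b) c n.
Proof.
pose P e := \poly_(i < n.+1) e i : {poly F}.
have -> : cauchyp a (cauchyp b c) n = (P a * (P b * P c))`_n.
  rewrite coefM; apply: eq_bigr => i _; rewrite coef_poly ltn_ord.
  by rewrite (cauchyp_poly _ _ (leq_subr i n)).
rewrite mulrA coefM; apply: eq_bigr => i _.
by rewrite (@cauchyp_poly a b n) -1?ltnS // coef_poly ltnS leq_subr.
Qed.

Lemma cauchypDl a b c n : cauchyp (fun i => a i + b i) c n = cauchyp a c n + cauchyp b c n.
Proof. by rewrite -big_split; apply: eq_bigr => i _; rewrite mulrDl. Qed.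

Lemma cauchypZl x a c n : cauchyp (fun i => x * a i) c n = x * cauchyp a c n.
Proof. by rewrite mulr_sumr; apply: eq_bigr => i _; rewrite mulrA. Qed.

Lemma cauchyp_delta a n : cauchyp a (fun i => (i == 0)%:R) n = a n.
Proof.
rewrite /cauchyp (bigD1 ord_max) //= subnn mulr1 big1 ?addr0 // => i ii.
rewrite subn_eq0 leqNgt ltn_neqAle -ltnS ltn_ord andbT.
by rewrite ii mulr0.
Qed.

(* With A and S the generating series of [a] and [s], this is the equation
   q dA/dq = S A, that is q d(log A)/dq = S. *)
Definition log_deriv a s := forall n, n%:R * a n = cauchyp s a n.

(** Leibniz rule: the factor n is split as i + (n - i) between the two series. *)
Lemma log_derivM a b s t : log_deriv a s -> log_deriv b t ->
  log_deriv (cauchyp a b) (fun n => s n + t n).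
Proof.
move=> as_ bt n.
have -> : n%:R * cauchyp a b n = cauchyp (cauchyp s a) b n + cauchyp a (cauchyp t b) n.
  rewrite mulr_sumr -big_split; apply: eq_bigr => i _ /=.
  rewrite -as_ -bt -{1}(subnKC (ltnSE (ltn_ord i))) natrD; ring.
rewrite cauchypDl !cauchypA; congr (_ + _).
by apply: eq_cauchyp => // i; exact: cauchypC.
Qed.

(** The recursion reads H = alpha q^p A + mu q^p H, hence H = alpha q^p / (1 - mu q^p) A; the kernel
    lists the coefficients of this geometric series. *)
Lemma log_deriv_geom (alpha mu : F) p a h : (0 < p)%N ->
  (forall n, h n = if (n < p)%N then 0
                   else alpha * a (n - p)%N + mu * h (n - p)%N) ->
  forall n, h n =
    cauchyp (fun k => if (p %| k)%N && (0 < k)%N then alpha * mu ^+ (k %/ p).-1 else 0) a n.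
Proof.
move=> p0 hE; set g := fun k => _; elim/ltn_ind => n IHn.
have g_small k : (k < p)%N -> g k = 0.
  move=> kp; rewrite /g; case: ifP => // /andP[/dvdn_leq le /le].
  by rewrite leqNgt kp.
rewrite hE; case: ltnP => pn.
  by rewrite /cauchyp big1 // => k _; rewrite g_small ?mul0r // (leq_trans (ltn_ord k)).
rewrite /cauchyp -(big_mkord xpredT (fun k => g k * a (n - k)%N)).
rewrite (big_cat_nat (n := p)) //=; last exact: leqW.
rewrite big_nat big1 ?add0r => [|k /g_small ->]; last by rewrite mul0r.
rewrite -[X in \sum_(X <= _ < _) _]add0n big_addn subSn // big_nat_recl // add0n.
rewrite {1}/g dvdnn p0 divnn p0 expr0 mulr1; congr (_ + _).
rewrite IHn; last by rewrite ltn_subrL p0 (leq_trans p0 pn).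
rewrite /cauchyp -(big_mkord xpredT (fun k => g k * a (n - p - k)%N)) big_nat_recl //.
rewrite g_small // mul0r add0r mulr_sumr; apply: eq_bigr => k _.
(* Away from the leading term k = p, the kernel at k + p is [mu] times the kernel at k. *)
rewrite mulrA -subnDA [(p + _)%N]addnC; congr (_ * _); rewrite /g dvdn_addl //.
rewrite (_ : (0 < k.+1 + p)%N) // ltn0Sn !andbT;
  case: ifP => [/dvdnP[q kq]|]; last by rewrite mulr0.
case: q kq => // q kq; rewrite kq divnDr // divnn p0 mulnK //= addn1 /=.
by rewrite exprS; ring.
Qed.

(* The guard matters: [divisors 0] is [[:: 1]]. *)
Definition div_sum (tau : nat -> F) k :=
  \sum_(p <- divisors k | (0 < k)%N) p%:R * tau (k %/ p)%N.

Lemma div_sum0 tau : div_sum tau 0 = 0.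
Proof. exact: big_pred0. Qed.

Lemma big_divisors (f : nat -> F) n k : (0 < k <= n)%N ->
  \sum_(p <- divisors k) f p = \sum_(l < n) if (l.+1 %| k)%N then f l.+1 else 0.
Proof.
move=> /andP[k0 kn]; rewrite -(big_mkord xpredT (fun l => if (l.+1 %| k)%N then f l.+1 else 0)).
rewrite -(big_add1 _ _ 0 n.+1 xpredT (fun l => if (l %| k)%N then f l else 0)).
rewrite -big_mkcond -big_filter; apply: perm_big; apply: uniq_perm.
- exact: divisors_uniq.
- by rewrite filter_uniq // iota_uniq.
move=> l; rewrite -dvdn_divisors // mem_filter mem_index_iota ltnS.
by case lk: (l %| k)%N => //=; rewrite (dvdn_gt0 k0 lk) (leq_trans (dvdn_leq k0 lk)).
Qed.

(* The character [a] of a Fock space whose modes [(i, l)] have degree l+1 and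
   number-weighted characters [h i l]. *)
Lemma log_deriv_modes (I : finType) (alpha mu : I -> F) a (h : I -> nat -> nat -> F) :
  (forall i l n, h i l n = if (n < l.+1)%N then 0
     else alpha i * a (n - l.+1)%N + mu i * h i l (n - l.+1)%N) ->
  (forall n, n%:R * a n = \sum_i \sum_(l < n) l.+1%:R * h i l n) ->
  log_deriv a (div_sum (fun j => \sum_i alpha i * mu i ^+ j.-1)).
Proof.
move=> hrec aE n; rewrite aE.
under eq_bigr => i _ do under eq_bigr => l _
  do rewrite (log_deriv_geom (ltn0Sn l) (hrec i l)) mulr_sumr.
under eq_bigr do rewrite exchange_big.
rewrite exchange_big /=; apply: eq_bigr => k _.
under eq_bigr do under eq_bigr do rewrite mulrA.
under eq_bigr do rewrite -mulr_suml.
(* The coefficient of a(n - k) collects the modes whose degree p = l+1 divides k, each with weight p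
   alpha mu^(k/p - 1); this is a divisor sum. *)
rewrite -mulr_suml; congr (_ * _); rewrite exchange_big /=.
have [k0|k0] := posnP (k : nat).
  rewrite k0 div_sum0 big1 // => l _; rewrite big1 // => i _.
  by rewrite andbF mulr0.
rewrite /div_sum k0 (@big_divisors _ n) ?k0 -1?ltnS ?ltn_ord //.
apply: eq_bigr => l _.
rewrite andbT; case: ifP => _; first by rewrite mulr_sumr.
by rewrite big1 // => i _; rewrite mulr0.
Qed.

End Convolution.

Section CharacteristicZero.
Context {F : numFieldType}.
Implicit Types a b c s t u : nat -> F.

Lemma log_deriv0 a : a 0%N = 1 -> log_deriv a (fun=> 0) ->
  forall n, a n = (n == 0)%:R.
Proof.
move=> a0 aE [|n]; first by rewrite a0.
have /eqP := aE n.+1; rewrite /cauchyp big1 => [|i _]; last by rewrite mul0r.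
by rewrite mulf_eq0 pnatr_eq0 /= => /eqP.
Qed.

(* If the product ABC of the generating series is 1, then
   (q dA/dq - e A) B C = q d(log A)/dq - e. *)
Lemma weighted_cauchyp a b c s t u (e : F) :
  a 0%N = 1 -> b 0%N = 1 -> c 0%N = 1 ->
  log_deriv a s -> log_deriv b t -> log_deriv c u ->
  (forall n, s n + (t n + u n) = 0) ->
  forall n, cauchyp (fun i => (i%:R - e) * a i) (cauchyp b c) n = s n - e * (n == 0)%:R.
Proof.
move=> a0 b0 c0 as_ bt cu stu n.
(* ABC has logarithmic derivative 0 and constant term 1. *)
have abc : cauchyp a (cauchyp b c) =1 (fun k => (k == 0)%:R).
  apply: log_deriv0; first by rewrite /cauchyp !big_ord1 a0 b0 c0 !mul1r.
  move=> k; have := log_derivM as_ (log_derivM bt cu) k.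
  by move=> ->; apply: eq_cauchyp => // i; exact: stu.
rewrite (@eq_cauchyp _ _ (fun i => cauchyp s a i + - e * a i) _ (cauchyp b c)) //; last first.
  by move=> i; rewrite -as_ mulrBl mulNr.
rewrite cauchypDl cauchypZl abc -cauchypA mulNr; congr (_ - _).
by rewrite (eq_cauchyp (fun=> erefl) abc) cauchyp_delta.
Qed.

End CharacteristicZero.

(** * Clifford modules and Koszul signs *)

Section Dilation.
Context {F : comNzRingType}.

Definition dilate N (a : nat -> F) n := if (N %| n)%N then a (n %/ N)%N else 0.

(** Chain rule: applying q d/dq to A(q^N) gives N times (q dA/dq) evaluated at q^N. *)
Lemma log_deriv_dilate N (a s : nat -> F) : (0 < N)%N -> log_deriv a s ->
  log_deriv (dilate N a) (fun k => N%:R * dilate N s k).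
Proof.
move=> N0 as_ n; rewrite {1}/dilate.
case: ifPn => [/dvdnP[q ->]|nN]; last first.
  rewrite mulr0 /cauchyp big1 // => k _; rewrite /dilate.
  case: ifP => kN; last by rewrite mulr0 mul0r.
  by rewrite dvdn_subl ?(negPf nN) ?mulr0 // -ltnS ltn_ord.
rewrite mulnK // natrM mulrAC as_ /cauchyp mulr_suml.
rewrite [RHS](bigID (fun k : 'I_(q * N).+1 => (N %| k)%N)) /=.
rewrite [X in _ + X]big1 ?addr0 => [|k /negPf kN]; last first.
  by rewrite /dilate kN mulr0 mul0r.
have lt_mul (k : 'I_q.+1) : (k * N < (q * N).+1)%N.
  by rewrite ltnS leq_pmul2r // -ltnS.
pose h (k : 'I_q.+1) : 'I_(q * N).+1 := Ordinal (lt_mul k).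
pose h' (k : 'I_(q * N).+1) : 'I_q.+1 := inord (k %/ N).
rewrite (reindex_onto h h') => [|k kN]; last first.
  apply: val_inj; rewrite /= inordK ?divnK // ltnS.
  by rewrite -(leq_pmul2r N0) divnK // -ltnS.
apply: eq_big => [k|k _].
  rewrite /= dvdn_mull //=; apply/esym/eqP/val_inj.
  by rewrite /= inordK ?mulnK.
rewrite /dilate /= dvdn_mull // -mulnBl dvdn_mull // !mulnK //; ring.
Qed.

End Dilation.

Lemma oppzS n : - n.+1%:Z = Negz n.
Proof. by rewrite NegzE. Qed.

Section CliffordFock.
Context {F : numFieldType}.

Definition set_weight (S : {fset nat}) : nat := (\sum_(s <- S) s.+1)%N.

Lemma cliff_mode_linear m : linear (@cliff_mode F m).
Proof. exact: lext_linear. Qed.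

HB.instance Definition _ m := GRing.isLinear.Build F (malg {fset nat} F)
  (malg {fset nat} F) _ (@cliff_mode F m) (cliff_mode_linear m).

Lemma cliff_mode_pos n S : cliff_mode n.+1%:Z (ket S) =
  if n \in S then (2 * cliff_sign n S) *: ket (S `\ n)%fset else 0 :> malg {fset nat} F.
Proof. exact: lext_ket. Qed.

Lemma cliff_mode_neg n S : cliff_mode (Negz n) (ket S) =
  if n \in S then 0 else cliff_sign n S *: ket (n |` S)%fset :> malg {fset nat} F.
Proof. exact: lext_ket. Qed.

Lemma cliff_mode0 S :
  cliff_mode 0 (ket S) = (-1) ^+ #|` S|%fset *: ket S :> malg {fset nat} F.
Proof. exact: lext_ket. Qed.

Lemma cliff_modeZ m c u : cliff_mode m (c *: u) = c *: cliff_mode m u :> malg {fset nat} F.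
Proof. exact: (linearZ_LR (@cliff_mode F m)). Qed.

(** Removing and reinserting n produce the same sign, since only the elements larger than n are
    counted, and the two signs cancel. The remaining 2 is absorbed by the factor 1/2 in L(0). *)
Lemma cliff_number n (S : {fset nat}) : n \in S ->
  cliff_mode (- n.+1%:Z) (cliff_mode n.+1%:Z (ket S)) = 2 *: ket S :> malg {fset nat} F.
Proof.
move=> nS; rewrite oppzS cliff_mode_pos nS cliff_modeZ cliff_mode_neg.
rewrite in_fsetD1 eqxx fsetD1K; last exact: nS.
cbn [negb andb].
have -> : cliff_sign n (S `\ n)%fset = cliff_sign n S :> F.
  rewrite /cliff_sign; congr (_ ^+ #|` _|%fset); apply/fsetP => k; rewrite !inE.
  by have [->|kn] := eqVneq k n; rewrite ?ltnn ?andbF.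
rewrite scalerA -mulrA (_ : cliff_sign n S * cliff_sign n S = 1) ?mulr1 //.
by rewrite /cliff_sign -expr2 sqrr_sign.
Qed.

Lemma cliff_L0_ket S :
  cliff_L0 (ket S) = (16%:R^-1 + (set_weight S)%:R) *: ket S :> malg {fset nat} F.
Proof.
rewrite /cliff_L0.
have modeE n : n.+1%:R *: cliff_mode (- n.+1%:Z) (cliff_mode n.+1%:Z (ket S)) =
    (if n \in S then 2 * n.+1%:R else 0) *: ket S :> malg {fset nat} F.
  case: ifPn => nS.
    by rewrite (cliff_number nS) scalerA [2 * _]mulrC; reflexivity.
  by rewrite cliff_mode_pos (negPf nS) linear0 scaler0 scale0r.
under eq_fsbigr do rewrite modeE.
(* Only the modes present in [S] contribute, so the sum over all n is finite. *)
rewrite (fsbigE (enum_fset S)); [|exact: fset_uniq|by []|]; last first.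
  by move=> n _ /negPf ->; rewrite scale0r.
rewrite -scaler_suml scalerA -scalerDl; congr ((_ + _) *: _).
rewrite /set_weight natr_sum mulr_sumr.
rewrite big_mkcond big_seq [RHS]big_seq; apply: eq_bigr => n nS.
by rewrite in_setT nS mulrA mulVf ?mul1r // pnatr_eq0.
Qed.

Section Exterior.
Context {I : finType}.
Local Notation K := {ffun I -> {fset nat}}.
Implicit Types (f : K).

Definition tw_weight f : nat := (\sum_i set_weight (f i))%N.
Definition tw_size f : nat := (\sum_i #|` f i|%fset)%N.

Lemma set_weight_ge (S : {fset nat}) n : n \in S -> (n < set_weight S)%N.
Proof. by move=> nS; rewrite /set_weight (big_fsetD1 n) //= leq_addr. Qed.

Lemma tw_weight_ge f i n : n \in f i -> (n < tw_weight f)%N.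
Proof.
move=> /set_weight_ge /leq_trans; apply.
by rewrite /tw_weight (bigD1 i) //= leq_addr.
Qed.

Lemma tw_weightE f n : tw_weight f = n ->
  tw_weight f = (\sum_i \sum_(l < n) (nat_of_ord l \in f i) * l.+1)%N.
Proof.
move=> fn; apply: eq_bigr => i _.
rewrite -(big_mkord xpredT (fun l => (l \in f i) * l.+1)%N).
rewrite (eq_bigr (fun l => if l \in f i then l.+1 else 0%N)) => [|l _]; last first.
  by case: ifP => _; rewrite ?mul1n.
rewrite -big_mkcond -big_filter; apply: perm_big; apply: uniq_perm => [||l].
- exact: fset_uniq.
- by rewrite filter_uniq // iota_uniq.
- rewrite mem_filter mem_index_iota /=; case: (boolP (l \in f i)) => //= lf.
  by rewrite -fn (tw_weight_ge lf).
Qed.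

Lemma tw_locally_finite : locally_finite tw_weight.
Proof.
move=> n; pose h (g : {ffun I -> {set 'I_n}}) : K :=
  [ffun i => [fset nat_of_ord l | l in g i]%fset].
apply: (sub_finite_set (B := [set h g | g in [set: {ffun I -> {set 'I_n}}]])).
  move=> f /= fn; exists [ffun i => [set l : 'I_n | nat_of_ord l \in f i]%SET] => //.
  apply/ffunP => i; rewrite !ffunE; apply/fsetP => l.
  apply/imfsetP/idP => /= [[k + ->]|lf]; first by rewrite !inE.
  have ln : (l < n)%N by rewrite -fn (tw_weight_ge lf).
  by exists (Ordinal ln); rewrite ?inE.
exact: finite_image.
Qed.

(** The coefficients of the product of (1 - q^l)^|I| over l > 0. The index type is arbitrary because
    it will be both the set of all Clifford factors and the set of cycles of a permutation. *)
Definition tw_sum n : F := \sum_(f <- level tw_weight n) (-1) ^+ tw_size f.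
Definition tw_mode_sum (i : I) (l n : nat) : F :=
  \sum_(f <- level tw_weight n) (l \in f i)%:R * (-1) ^+ tw_size f.

Lemma tw_sum_modes n :
  n%:R * tw_sum n = \sum_i \sum_(l < n) l.+1%:R * tw_mode_sum i l n.
Proof.
rewrite /tw_sum mulr_sumr; transitivity (\sum_(f <- level tw_weight n)
    \sum_i \sum_(l < n) l.+1%:R * ((nat_of_ord l \in f i)%:R * (-1) ^+ tw_size f : F));
  last first.
  rewrite exchange_big; apply: eq_bigr => i _.
  by rewrite exchange_big; apply: eq_bigr => l _; rewrite -mulr_sumr.
rewrite big_seq [RHS]big_seq; apply: eq_bigr => f.
rewrite mem_level; last exact: tw_locally_finite.
move=> /eqP fn; rewrite -{1}fn (tw_weightE fn) natr_sum mulr_suml.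
apply: eq_bigr => i _; rewrite natr_sum mulr_suml; apply: eq_bigr => l _.
by rewrite natrM; ring.
Qed.

(** Exclusion principle: inserting l at i is a bijection from the configurations of weight n - (l+1)
    without that mode, and it flips the sign. Those without the mode are all minus those with it,
    whence the coefficients -1 and 1. *)
Lemma tw_mode_sum_rec i l n : tw_mode_sum i l n =
  if (n < l.+1)%N then 0
  else -1 * tw_sum (n - l.+1) + 1 * tw_mode_sum i l (n - l.+1).
Proof.
have fin := tw_locally_finite; rewrite {1}/tw_mode_sum.
case: ltnP => ln.
  rewrite big_seq big1 // => f; rewrite mem_level // => /eqP fn.
  case: (boolP (l \in f i)) => [/tw_weight_ge|]; last by rewrite mul0r.
  by rewrite fn ltnNge -ltnS ln.
pose up f : K := [ffun j => if j == i then (l |` f j)%fset else f j].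
have upi f : up f i = (l |` f i)%fset by rewrite ffunE eqxx.
have upj f j : j != i -> up f j = f j by rewrite ffunE => /negPf ->.
have up_weight f : l \notin f i -> tw_weight (up f) = (l.+1 + tw_weight f)%N.
  move=> lf; rewrite /tw_weight !(bigD1 i (P := xpredT)) //= upi addnA; congr (_ + _)%N.
    by rewrite /set_weight big_fsetU1.
  by apply: eq_bigr => j ji; rewrite upj.
have up_size f : l \notin f i -> tw_size (up f) = (tw_size f).+1.
  move=> lf; rewrite /tw_size !(bigD1 i (P := xpredT)) //= upi cardfsU1 lf.
  by rewrite add1n addSn; congr (_ + _).+1; apply: eq_bigr => j ji; rewrite upj.
pose D := [fset f in level tw_weight (n - l.+1) | l \notin f i]%fset.
pose E := [fset up f | f in D]%fset.
have EE f : (f \in E) = (f \in level tw_weight n) && (l \in f i).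
  rewrite mem_level //; apply/imfsetP/andP => /= [[f' + ->]|[/eqP fn lf]].
    rewrite !inE mem_level // => /andP[/eqP f'n lf'].
    by rewrite up_weight // f'n subnKC // eqxx upi !inE eqxx.
  pose f' : K := [ffun j => if j == i then (f j `\ l)%fset else f j].
  have lf' : l \notin f' i by rewrite ffunE eqxx !inE eqxx.
  have fE : f = up f'.
    apply/ffunP => j; rewrite !ffunE; case: eqP => [->|//].
    by rewrite fsetD1K.
  exists f' => //; rewrite !inE mem_level // lf' andbT.
  by rewrite -fn fE up_weight // addKn.
transitivity (\sum_(f <- E) (-1) ^+ tw_size f : F).
  rewrite (eq_bigr (fun f => if l \in f i then (-1) ^+ tw_size f else 0)); last first.
    by move=> f _; case: ifP; rewrite ?mul1r ?mul0r.
  rewrite -big_mkcond -big_filter; apply: perm_big; apply: uniq_perm => [||f].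
  - by rewrite filter_uniq // fset_uniq.
  - exact: fset_uniq.
  - by rewrite mem_filter EE andbC.
rewrite big_imfset /=; last first.
  move=> f1 f2; rewrite !inE => /andP[_ lf1] /andP[_ lf2] f12; apply/ffunP => j.
  have [ji|ji] := eqVneq j i; last by rewrite -(upj f1) // -(upj f2) // f12.
  rewrite ji -(fsetU1K lf1) -(fsetU1K lf2) -!upi f12 //.
rewrite mulN1r mul1r addrC -sumrB.
transitivity (\sum_(f <- level tw_weight (n - l.+1) | l \notin f i) (-1) ^+ (tw_size f).+1 : F).
  rewrite -[RHS]big_filter [RHS](perm_big (D : seq K)) /=; last first.
    apply: uniq_perm => [||f]; rewrite ?fset_uniq ?filter_uniq ?fset_uniq //.
    by rewrite mem_filter !inE andbC.
  rewrite big_seq [RHS]big_seq; apply: eq_bigr => f.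
  by rewrite !inE => /andP[_ lf]; rewrite up_size.
rewrite big_mkcond; apply: eq_bigr => f _; rewrite exprS mulN1r.
by case: (l \in f i); rewrite /= ?mul1r ?subrr ?mul0r ?sub0r.
Qed.

Lemma tw_sum_log_deriv : log_deriv tw_sum (div_sum (fun=> - #|I|%:R)).
Proof.
have := log_deriv_modes tw_mode_sum_rec tw_sum_modes.
move=> ld n; rewrite ld; apply: eq_cauchyp => // k; apply: eq_bigr => p _; congr (_ * _).
under eq_bigr do rewrite expr1n mulr1.
by rewrite sumr_const mulNrn.
Qed.

Lemma tw_sum0 : tw_sum 0 = 1.
Proof.
have fin := tw_locally_finite.
pose z : K := [ffun=> fset0].
rewrite /tw_sum (_ : level tw_weight 0 = [fset z]%fset) ?big_seq_fset1.
  by rewrite /tw_size big1 // => i _; rewrite ffunE cardfs0.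
apply/fsetP => f; rewrite mem_level // !inE; apply/eqP/eqP => [f0|->].
  apply/ffunP => i; rewrite ffunE; apply/fsetP => l; rewrite [in RHS]inE.
  by apply/negP => /tw_weight_ge; rewrite f0.
by rewrite /tw_weight big1 // => i _; rewrite ffunE /set_weight big_seq_fset0.
Qed.

End Exterior.
End CliffordFock.

(** * Koszul signs of permutations *)

Section Koszul.
Context {F : numFieldType} {M : nat}.
Implicit Types (s t : 'S_M) (n : 'I_M -> nat).

(** The sign of the reordering that [s] induces on the factors with [n i] odd. *)
Definition koszul s n : F :=
  \prod_(i < M) \prod_(j < M | (i < j)%N && (s j < s i)%N) (-1) ^+ (n i * n j).

Lemma koszul_pairs s n : koszul s n =
  \prod_(p : 'I_M * 'I_M | (p.1 < p.2)%N && (s p.2 < s p.1)%N) (-1) ^+ (n p.1 * n p.2).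
Proof. exact: pair_big_dep. Qed.

Lemma perm_lt_neq s (i j : 'I_M) : i != j -> (s j < s i)%N = ~~ (s i < s j)%N.
Proof.
rewrite -(inj_eq (@perm_inj _ s)) -val_eqE /= => sij.
by rewrite -leqNgt [in RHS]leq_eqVlt eq_sym (negPf sij).
Qed.

(** Both sides are the product over unordered pairs; a pair ordered differently by [s] is
    swapped. *)
Lemma prod_pairs_perm s (g : 'I_M -> 'I_M -> F) : (forall i j, g i j = g j i) ->
  \prod_(p : 'I_M * 'I_M | (s p.1 < s p.2)%N) g p.1 p.2 =
  \prod_(p : 'I_M * 'I_M | (p.1 < p.2)%N) g p.1 p.2.
Proof.
move=> gC; rewrite (bigID (fun p : 'I_M * 'I_M => (p.1 < p.2)%N)) /=.
rewrite [RHS](bigID (fun p : 'I_M * 'I_M => (s p.1 < s p.2)%N)) /=; congr (_ * _).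
  by apply: eq_bigl => p; rewrite andbC.
pose sw (p : 'I_M * 'I_M) := (p.2, p.1).
rewrite (reindex_onto sw sw) => [|[i j] _] //=; apply: eq_big => [[i j] /=|[i j] _ /=].
  rewrite eqxx andbT; have [->|ij] := eqVneq i j; first by rewrite !ltnn.
  have := perm_lt_neq s ij; have := perm_lt_neq 1 ij; rewrite !perm1 => -> ->.
  by rewrite negbK andbC.
by rewrite gC.
Qed.

(** The indicator [c u i j] that u inverts a pair is additive modulo 2: the pair is inverted by
    [s * t] exactly when one, but not both, of s on (i, j) and t on (s i, s j) inverts. *)
Lemma koszulM s t n :
  koszul (s * t)%g n = koszul s n * koszul t (fun i => n ((s^-1)%g i)).
Proof.
pose c (u : 'S_M) (i j : 'I_M) : bool := (i < j)%N (+) (u i < u j)%N.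
pose w (u : 'S_M) (m : 'I_M -> nat) i j : F := if c u i j then (-1) ^+ (m i * m j) else 1.
have koszulE u m : koszul u m = \prod_(p : 'I_M * 'I_M | (p.1 < p.2)%N) w u m p.1 p.2.
  rewrite koszul_pairs big_mkcondr; apply: eq_bigr => -[i j] /= ij.
  by rewrite /w /c ij /= (perm_lt_neq u) // neq_ltn ij.
rewrite !koszulE.
have -> : \prod_(p : 'I_M * 'I_M | (p.1 < p.2)%N) w t (fun i => n ((s^-1)%g i)) p.1 p.2 =
    \prod_(p : 'I_M * 'I_M | (p.1 < p.2)%N)
       (if c t (s p.1) (s p.2) then (-1) ^+ (n p.1 * n p.2) else 1).
  pose h (p : 'I_M * 'I_M) := (s p.1, s p.2).
  pose h' (p : 'I_M * 'I_M) := ((s^-1)%g p.1, (s^-1)%g p.2).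
  rewrite (reindex_onto h h') => [|[i j] _]; last by rewrite /h /h' /= !permKV.
  rewrite -(prod_pairs_perm s (g := fun i j =>
    if c t (s i) (s j) then (-1) ^+ (n i * n j) else 1)) => [|i j].
    apply: eq_big => [[i j]|[i j] _]; rewrite /h /h' /w /= !permK ?eqxx ?andbT //.
  rewrite mulnC /c; have [->//|ij] := eqVneq i j.
  rewrite (perm_lt_neq t (i := s i)) ?(inj_eq perm_inj) // (perm_lt_neq s ij).
  by rewrite addbN addNb negbK.
rewrite -big_split; apply: eq_bigr => -[i j] /= ij; rewrite /w /c !permM ij.
case: (s i < s j)%N; case: (t _ < t _)%N; rewrite /= ?mulr1 ?mul1r //.
by rewrite -expr2 sqrr_sign.
Qed.

Lemma koszul1 n : koszul 1 n = 1.
Proof.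
rewrite koszul_pairs big_pred0 // => -[i j] /=; rewrite !perm1.
by case: ltngtP.
Qed.

Lemma koszul_sqr s n : koszul s n * koszul s n = 1.
Proof. by rewrite koszul_pairs -big_split big1 // => p _; rewrite /= -expr2 sqrr_sign. Qed.

Lemma eq_koszul s n n' : n =1 n' -> koszul s n = koszul s n'.
Proof. by move=> nn; apply: eq_bigr => i _; apply: eq_bigr => j _; rewrite !nn. Qed.

(** On parities invariant under [s] the cocycle of [koszulM] restricts to a homomorphism. *)
Lemma koszulX s n k : (forall i, n (s i) = n i) -> koszul (s ^+ k)%g n = koszul s n ^+ k.
Proof.
move=> ns; have ns' i : n ((s^-1)%g i) = n i by rewrite -ns permKV.
elim: k => [|k IHk]; first by rewrite expg0 koszul1.
by rewrite expgS koszulM exprS (eq_koszul _ ns') IHk.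
Qed.

(* The inversions [(i, j)] of an involution are permuted by
   [(i, j) |-> (s j, s i)]; the only fixed ones are [(i, s i)]. *)
Lemma koszul_involution s n : (s * s = 1)%g -> (forall i, n (s i) = n i) ->
  koszul s n = \prod_(i < M | (i < s i)%N) (-1) ^+ n i.
Proof.
move=> ss ns; have sK i : s (s i) = i by rewrite -permM ss perm1.
rewrite koszul_pairs (bigID (fun p : 'I_M * 'I_M => s p.2 == p.1)) /=.
rewrite [X in _ * X](_ : _ = 1) ?mulr1.
  rewrite (reindex_onto (fun i => (i, s i)) (fun p => p.1)) /=; last first.
    by move=> [i j] /= /andP[_ /eqP <-]; rewrite sK.
  apply: eq_big => [i|i _]; first by rewrite sK !eqxx !andbT andbb.
  by rewrite ns -signr_odd oddM andbb signr_odd.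
(* The map (i, j) to (s j, s i) exchanges the inversions with i < s j and those with s j < i, so
   their signs cancel in pairs. *)
rewrite (bigID (fun p : 'I_M * 'I_M => (p.1 < s p.2)%N)) /=.
pose h (p : 'I_M * 'I_M) := (s p.2, s p.1).
rewrite [X in _ * X](reindex_onto h h) /=; last by move=> [i j] _; rewrite /h /= !sK.
set A := \prod_(_ | _) _; set B := \prod_(_ | _) _.
suff -> : B = A by rewrite /A -big_split big1 // => p _; rewrite /= -expr2 sqrr_sign.
apply: eq_big => [[i j]|[i j] _] /=; last by rewrite !ns mulnC.
rewrite /h /= !sK eqxx andbT [(s j < s i)%N && _]andbC -!andbA; congr [&& _, _ & _].
rewrite -leqNgt leq_eqVlt [X in _ && (X || _)]eq_sym -!val_eqE /=.
rewrite eq_sym; case: (ltngtP (s j) i) => //=.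
Qed.

End Koszul.

(** * Permutations of the twisted Clifford factors *)

Section TwistedOperators.
Context {F : numFieldType} {M : nat}.
Local Notation K := {ffun 'I_M -> {fset nat}}.
Local Notation V := (malg K F).
Implicit Types (s t : 'S_M) (f : K).

Definition perm_ffun s f : K := [ffun i => f ((s^-1)%g i)].
Definition sizes f (i : 'I_M) : nat := #|` f i|%fset.

Lemma tw_L0_ket f : tw_L0 (ket f) = (M%:R / 16%:R + (tw_weight f)%:R) *: ket f :> V.
Proof.
rewrite /tw_L0; under eq_bigr do rewrite (tens_at_diag _ cliff_L0_ket).
rewrite -scaler_suml big_split /= sumr_const card_ord -natr_sum.
by rewrite -[_ *+ M]mulr_natl.
Qed.

Lemma tw_ptilde_ket f : tw_ptilde (ket f) = (-1) ^+ tw_size f *: ket f :> V.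
Proof.
rewrite /tw_ptilde /tw_size -prodrXr.
elim/big_rec2: _ => [|i c T _ Tf]; first by rewrite scale1r.
by rewrite /= Tf linearZ /= (tens_at_diag _ cliff_mode0) scalerA mulrC.
Qed.

Lemma tw_perm_linear s : linear (@tw_perm F M s).
Proof. exact: lext_linear. Qed.

HB.instance Definition _ s := GRing.isLinear.Build F V V _ (@tw_perm F M s) (tw_perm_linear s).

Lemma tw_perm_ket s f : tw_perm s (ket f) = koszul s (sizes f) *: ket (perm_ffun s f) :> V.
Proof. exact: lext_ket. Qed.

Lemma tw_perm_comp s t (u : V) : tw_perm t (tw_perm s u) = tw_perm (s * t)%g u.
Proof.
move: u; apply: (eq_on_kets (S := tw_perm t \o tw_perm s)) => f /=.
rewrite !tw_perm_ket linearZ /= tw_perm_ket scalerA koszulM; congr (_ * _ *: ket _).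
  by apply: eq_koszul => i; rewrite /sizes ffunE.
by apply/ffunP => i; rewrite !ffunE invMg permM.
Qed.

Lemma tw_perm1 (u : V) : tw_perm 1%g u = u.
Proof.
move: u; apply: (eq_on_kets (S := tw_perm 1%g) (T := idfun)) => f /=.
rewrite tw_perm_ket koszul1 scale1r; congr (ket _).
by apply/ffunP => i; rewrite ffunE invg1 perm1.
Qed.

Lemma tw_weight_perm s f : tw_weight (perm_ffun s f) = tw_weight f.
Proof.
rewrite /tw_weight (reindex_inj (@perm_inj _ s)) /=.
by apply: eq_bigr => i _; rewrite ffunE permK.
Qed.

Lemma tw_size_perm s f : tw_size (perm_ffun s f) = tw_size f.
Proof.
rewrite /tw_size (reindex_inj (@perm_inj _ s)) /=.
by apply: eq_bigr => i _; rewrite ffunE permK.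
Qed.

(* The coefficients of tr(sigma ptilde q^L_2(0)), up to the power of q coming
   from the vacuum. *)
Definition perm_sum s n : F :=
  \sum_(f <- level (@tw_weight 'I_M) n)
    (perm_ffun s f == f)%:R * koszul s (sizes f) * (-1) ^+ tw_size f.

Lemma perm_sum1 n : perm_sum 1%g n = tw_sum (I := 'I_M) n.
Proof.
apply: eq_bigr => f _; rewrite koszul1 (_ : perm_ffun 1%g f = f) ?eqxx ?mul1r //.
by apply/ffunP => i; rewrite ffunE invg1 perm1.
Qed.

Lemma porbit_in_porbits s i : porbit s i \in porbits s.
Proof. by apply: imset_f; rewrite inE. Qed.

Section CycleShape.
Variables (N k : nat) (s : 'S_M).
Hypotheses (pN : prime N) (sN : cycle_shape s N k).
Let I := {X : {set 'I_M} | X \in porbits s}.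

Let orbit_of (i : 'I_M) : I :=
  exist _ (porbit s i) (porbit_in_porbits s i).

Let N_gt0 : (0 < N)%N := prime_gt0 pN.

Lemma card_porbits_type : #|{: I}| = k.
Proof. by rewrite card_sig -(proj1 sN); apply: eq_card => X; rewrite inE. Qed.

Lemma cycle_shape_expgN : (s ^+ N = 1)%g.
Proof.
apply/permP => i; rewrite perm1 permX -(proj2 sN (porbit s i)) ?porbit_in_porbits //.
exact: iter_porbit.
Qed.

Lemma orbit_of_eq i (X : I) : (orbit_of i == X) = (i \in val X).
Proof.
rewrite -(inj_eq val_inj) -[val (orbit_of i)]/(porbit s i).
by have /imsetP[j _ ->] := valP X; exact: eq_porbit_mem.
Qed.

Lemma sum_orbits (n : I -> nat) : (\sum_i n (orbit_of i) = N * \sum_X n X)%N.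
Proof.
rewrite (partition_big orbit_of xpredT) //= big_distrr /=; apply: eq_bigr => X _.
rewrite (eq_bigr (fun=> n X)) => [|i /eqP -> //].
rewrite sum_nat_const -(proj2 sN (val X) (valP X)); congr (_ * _)%N.
by apply: eq_card => i; exact: orbit_of_eq.
Qed.

Lemma cycle_shape_card : M = (N * k)%N.
Proof.
have := sum_orbits (fun=> 1%N); rewrite !sum1_card card_ord => ->.
by rewrite card_porbits_type.
Qed.

(** For odd N the sign of [s] has both its square and its N-th power equal to 1, hence is 1, and
    (-1)^N = -1 reduces the parity of N equal factors to that of one. For N = 2 the total size is
    even, so ptilde contributes nothing, and the sign of the involution [s] counts one factor of
    each 2-cycle. *)
Lemma koszul_orbits (n : I -> nat) j : ~~ (N %| j)%N ->
  koszul (s ^+ j)%g (n \o orbit_of) * (-1) ^+ (\sum_i n (orbit_of i)) =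
  (-1) ^+ (\sum_X n X) :> F.
Proof.
have inv i : orbit_of (s i) = orbit_of i.
  by apply: val_inj; have := porbit_perm s 1 i; rewrite expg1.
have ninv i : (n \o orbit_of) (s i) = (n \o orbit_of) i by rewrite /= inv.
move=> Nj; rewrite koszulX // sum_orbits.
have sq : koszul s (n \o orbit_of) ^+ 2 = 1 :> F by rewrite expr2 koszul_sqr.
have kN : koszul s (n \o orbit_of) ^+ N = 1 :> F.
  by rewrite -koszulX // cycle_shape_expgN koszul1.
case: (even_prime pN) => [N2|oN]; last first.
  have -> : koszul s (n \o orbit_of) = 1 :> F.
    by rewrite -kN -[N](odd_double_half N) oN -mul2n add1n exprS exprM sq expr1n mulr1.
  by rewrite expr1n mul1r -signr_odd oddM oN signr_odd.
have jodd : odd j by rewrite N2 dvdn2 negbK in Nj.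
have ss : (s * s = 1)%g by have := cycle_shape_expgN; rewrite N2 expgS expg1.
rewrite -[j](odd_double_half j) jodd -mul2n add1n exprS exprM sq expr1n mulr1.
rewrite exprM N2 sqrrN !expr1n mulr1 koszul_involution // prodrXr.
congr (_ ^+ _).
have sK i : s (s i) = i by rewrite -permM ss perm1.
have sneq i : s i != i.
  apply/eqP => si; have: #|porbit s i| = 1%N.
    apply/eqP/cards1P; exists i; apply/setP => l; rewrite !inE.
    apply/porbitP/eqP => [[p ->]|->]; last by exists 0%N; rewrite expg0 perm1.
    by rewrite permX; elim: p => //= p ->.
  by rewrite (proj2 sN) ?porbit_in_porbits // N2.
(* Twice the sum over i < s i is the sum over all i, because [s] has no fixed point and exchanges
   the two halves. *)
apply/eqP; rewrite -(eqn_pmul2l (isT : 0 < 2)%N) -[in X in _ == X]N2 -sum_orbits.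
rewrite [X in _ == X](bigID (fun i : 'I_M => (i < s i)%N)) /= mul2n -addnn.
rewrite eqn_add2l; apply/eqP.
rewrite [RHS](reindex_inj (@perm_inj _ s)) /=.
apply: eq_big => [i|i _]; last by rewrite inv.
rewrite sK; have := sneq i; rewrite -val_eqE /=; by case: ltngtP.
Qed.

(** Only fixed configurations count; they are the pullbacks [h g] of configurations g on the set of
    cycles, of weight N times that of g, and [koszul_orbits] evaluates their sign. *)
Lemma perm_sum_cycle j : ~~ (N %| j)%N ->
  perm_sum (s ^+ j)%g =1 dilate N (tw_sum (I := I)).
Proof.
move=> Nj n; have finM := @tw_locally_finite 'I_M; have finI := @tw_locally_finite I.
pose h (g : {ffun I -> {fset nat}}) : K := [ffun i => g (orbit_of i)].
have hW g : tw_weight (h g) = (N * tw_weight g)%N.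
  by rewrite /tw_weight -sum_orbits; apply: eq_bigr => i _; rewrite ffunE.
have hS g : tw_size (h g) = (\sum_i #|` g (orbit_of i)|%fset)%N.
  by apply: eq_bigr => i _; rewrite ffunE.
have orb_surj X : exists i, orbit_of i = X.
  by have /imsetP[i _ Xi] := valP X; exists i; apply: val_inj.
have h_inj : injective h.
  move=> g1 g2 /ffunP g12; apply/ffunP => X; have [i <-] := orb_surj X.
  by have := g12 i; rewrite !ffunE.
have fixP f : reflect (exists g, f = h g) (perm_ffun (s ^+ j)%g f == f).
  apply: (iffP eqP) => [ff|[g ->]]; last first.
    apply/ffunP => i; rewrite !ffunE; congr (g _); apply: val_inj => /=.
    by rewrite -[in RHS](permKV (s ^+ j)%g i) porbit_perm.
  have fj p i : f (((s ^+ j) ^+ p)%g i) = f i.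
    elim: p i => [|p IHp] i; first by rewrite expg0 perm1.
    by rewrite expgS permM IHp -{1}ff ffunE permK.
  (* Bezout: j is invertible modulo the prime N, so s is a power of s^j and both have the same fixed
     configurations. *)
  have [u uj] : exists u, ((s ^+ j) ^+ u = s)%g.
    have cop : coprime j N by rewrite coprime_sym prime_coprime.
    exists (egcdn j N).1.
    have j0 : (0 < j)%N by case: (j) Nj => //; rewrite dvdn0.
    rewrite -expgM; case: (egcdnP N j0) => u v uv _ /=.
    rewrite mulnC uv (eqP cop) expgD mulnC expgM cycle_shape_expgN expg1n mul1g.
    by rewrite expg1.
  have fs p i : f ((s ^+ p)%g i) = f i 
    by rewrite (_ : s ^+ p = (s ^+ j) ^+ (u * p))%g ?fj // expgM uj.
  have /choice[r rP] := orb_surj.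
  exists [ffun X => f (r X)]; apply/ffunP => i; rewrite !ffunE.
  have /porbitP[p ip] : i \in porbit s (r (orbit_of i)).
    by rewrite -eq_porbit_mem -[porbit s (r _)]/(val (orbit_of (r (orbit_of i)))) rP.
  by rewrite {1}ip fs.
rewrite /perm_sum (eq_bigr (fun f => if perm_ffun (s ^+ j)%g f == f
  then koszul (s ^+ j)%g (sizes f) * (-1) ^+ tw_size f else 0)); last first.
  by move=> f _; case: eqP; rewrite ?mul1r ?mul0r.
rewrite -big_mkcond -big_filter /dilate; case: ifPn => Nn; last first.
  rewrite big_seq big_pred0 // => f; rewrite mem_filter mem_level //.
  apply/negP => /andP[/fixP[g ->]]; rewrite hW => /eqP nN.
  by rewrite -nN dvdn_mulr in Nn.
rewrite (perm_big [fset h g | g in level (@tw_weight I) (n %/ N)]%fset) /=.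
  rewrite big_imfset /= => [|g1 g2 _ _]; last exact: h_inj.
  apply: eq_bigr => g _; rewrite hS /tw_size.
  rewrite -(koszul_orbits (fun X => #|` g X|%fset) Nj); congr (_ * _).
  by apply: eq_koszul => i; rewrite /sizes ffunE.
apply: uniq_perm => [||f]; rewrite ?filter_uniq ?fset_uniq // mem_filter mem_level //.
apply/andP/imfsetP => /= [[/fixP[g ->]]|[g + ->]].
  rewrite hW => /eqP nN; exists g => //.
  by rewrite mem_level // -nN mulKn.
rewrite mem_level // hW => /eqP ->; rewrite mulnC divnK //; split=> //.
by apply/fixP; exists g.
Qed.

Lemma perm_sum_log_deriv j : ~~ (N %| j)%N ->
  log_deriv (perm_sum (s ^+ j)%g)
    (fun n => N%:R * dilate N (div_sum (fun=> - k%:R)) n).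
Proof.
move=> Nj n; rewrite (perm_sum_cycle Nj).
rewrite (log_deriv_dilate N_gt0 (@tw_sum_log_deriv F I)) card_porbits_type.
by apply: eq_cauchyp => // i; rewrite (perm_sum_cycle Nj).
Qed.

End CycleShape.
End TwistedOperators.

(** * Complex series and the Eisenstein series *)

Section ComplexSeries.
Context {R : realType}.
Local Notation C := (Cplx R).
Local Open Scope complex_scope.

Lemma normc_le_ReIm (z : C) : `|z| <= (`|complex.Re z| + `|complex.Im z|)%:C.
Proof.
rewrite normc_def lecR -[leRHS]ger0_norm ?addr_ge0 // -(sqrtr_sqr (_ + _)).
apply: ler_wsqrtr; rewrite sqrrD.
by rewrite !real_normK ?num_real // addrAC lerDl mulrn_wge0 // mulr_ge0.
Qed.

Lemma cvg_complex (u : nat -> C) (x y : R) :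
  (fun n => complex.Re (u n)) @ \oo --> x -> (fun n => complex.Im (u n)) @ \oo --> y ->
  u @ \oo --> (x +i* y : C).
Proof.
move=> ux uy; apply/cvgrPdist_lt => -[e e'] /=.
(* A positive complex number is real. *)
rewrite ltcE /= => /andP[/eqP -> e0].
have e20 : 0 < e / 2 by rewrite divr_gt0.
move/cvgrPdist_lt/(_ _ e20): ux => ux; move/cvgrPdist_lt/(_ _ e20): uy => uy.
near=> n; apply: le_lt_trans (normc_le_ReIm _) _.
rewrite -[_ +i* 0]/(e%:C) ltcR [e]splitr.
have Re_n : complex.Re (x +i* y - u n) = x - complex.Re (u n) by case: (u n).
have Im_n : complex.Im (x +i* y - u n) = y - complex.Im (u n) by case: (u n).
rewrite Re_n Im_n; apply: ltrD; near: n; [exact: ux|exact: uy].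
Unshelve. all: by end_near. Qed.

Lemma Re_sum (I : Type) (r : seq I) (f : I -> C) :
  complex.Re (\sum_(i <- r) f i) = \sum_(i <- r) complex.Re (f i).
Proof. by elim/big_rec2: _ => // i x y _ <-; case: (f i); case: y. Qed.

Lemma Im_sum (I : Type) (r : seq I) (f : I -> C) :
  complex.Im (\sum_(i <- r) f i) = \sum_(i <- r) complex.Im (f i).
Proof. by elim/big_rec2: _ => // i x y _ <-; case: (f i); case: y. Qed.

(** Real and imaginary parts are each dominated by [v], so the comparison test for real series
    applies to both. *)
Lemma dominated_series_cvg (u : nat -> C) (v : nat -> R) :
  (forall n, `|u n| <= (v n)%:C) -> cvgn (series v) -> cvgn (series u).
Proof.
move=> uv cv; have v0 n : 0 <= v n.
  by have := le_trans (normr_ge0 _) (uv n); rewrite ler0c.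
have ReC (w : nat -> R) : (forall n, `|w n| <= v n) -> cvgn (series w).
  by move=> wv; apply: normed_cvg; apply: (series_le_cvg _ v0 _ cv) => n //=.
have cRe : cvgn (series (fun n => complex.Re (u n))).
  by apply: ReC => n; rewrite -lecR; apply: le_trans (uv n); exact: normc_ge_Re.
have cIm : cvgn (series (fun n => complex.Im (u n))).
  apply: ReC => n; rewrite -lecR; apply: le_trans (uv n).
  case: (u n) => a b; rewrite normc_def lecR -sqrtr_sqr; apply: ler_wsqrtr.
  by rewrite lerDr sqr_ge0.
apply/cvg_ex; exists (limn (series (fun n => complex.Re (u n))) +i*
  limn (series (fun n => complex.Im (u n)))).
apply: cvg_complex.
  rewrite (_ : (fun n => _) = series (fun n => complex.Re (u n))) //.
  by apply/funext => n; rewrite /series /= Re_sum.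
rewrite (_ : (fun n => _) = series (fun n => complex.Im (u n))) //.
by apply/funext => n; rewrite /series /= Im_sum.
Qed.

(** Agrees with [sigma1] at positive n but vanishes at 0, so that the series can start at n = 0. *)
Definition sigma1_coef (n : nat) : C := div_sum (fun=> 1) n.

Lemma sigma1_coef0 : sigma1_coef 0 = 0. Proof. exact: div_sum0. Qed.

Lemma sigma1_coefS n : sigma1_coef n.+1 = (sigma1 n.+1)%:R.
Proof. by rewrite /sigma1_coef /div_sum /sigma1 natr_sum; apply: eq_bigr => p _; rewrite mulr1. Qed.

Lemma sigma1_le n : (sigma1 n.+1 <= n.+1 ^ 2)%N.
Proof.
rewrite -(ler_nat R) /sigma1 natr_sum (@big_divisors _ _ n.+1) ?leqnn //.
apply: (@le_trans _ _ (\sum_(l < n.+1) n.+1%:R)); last first.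
  by rewrite sumr_const card_ord natrX expr2 mulr_natl.
apply: ler_sum => l _.
by case: ifP => _; rewrite ?ler0n // ler_nat ltn_ord.
Qed.

(** With x = 1 - 4h, the bound n h <= (1 + h)^n gives n^2 <= h^-2 (1 + h)^(2n), and the ratio (1 +
    h)^2 (1 - 4h) is still below 1. *)
Lemma sq_le_geometric (x : R) : 0 <= x -> x < 1 ->
  exists (a z : R), [/\ 0 <= z, z < 1 & forall n, (n ^ 2)%:R * x ^+ n <= a * z ^+ n].
Proof.
move=> x0 x1; have [h [h0 h1 xE]] : exists h, [/\ 0 < h, h <= 1 & x = 1 - 4 * h].
  by exists ((1 - x) / 4); split; [lra|lra|field].
exists (h ^- 2), ((1 + h) ^+ 2 * x); split.
- by rewrite mulr_ge0 // exprn_ge0 //; lra.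
- by rewrite expr2; nra.
move=> n; rewrite exprMn mulrA; apply: ler_wpM2r; first exact: exprn_ge0.
rewrite mulrC ler_pdivlMr ?exprn_gt0 // natrX -exprMn -!exprM mulnC exprM.
rewrite ler_pXn2r ?nnegrE;
  [|by []|by rewrite mulr_ge0 ?ler0n // ltW|by apply: exprn_ge0; lra].
elim: n => [|n IHn]; first by rewrite mul0r expr0.
rewrite exprS -natr1 mulrDl mul1r.
have : 1 <= (1 + h) ^+ n by rewrite exprn_ege1 //; lra.
by nra.
Qed.

Lemma sigma1_series_cvg (q : C) : `|q| < 1 -> cvgn (series (fun n => sigma1_coef n * q ^+ n)).
Proof.
have qE : `|q| = (complex.Re `|q|)%:C by rewrite RRe_real // normr_real.
set x := complex.Re `|q| in qE.
have x0 : 0 <= x by have := normr_ge0 q; rewrite qE ler0c.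
rewrite qE -[1]/(1%:C) ltcR => x1.
have [a [z [z0 z1 az]]] := sq_le_geometric x0 x1.
apply: (@dominated_series_cvg _ (geometric a z)); last first.
  by apply: is_cvg_geometric_series; rewrite ger0_norm.
case=> [|n].
  rewrite sigma1_coef0 mul0r normr0 -[0]/(0%:C) lecR /= expr0 mulr1.
  by have := az 0%N; rewrite mul0r expr0 mulr1.
rewrite normrM normrX qE sigma1_coefS normr_nat -[X in X * _](rmorph_nat (real_complex R)).
rewrite -rmorphXn -rmorphM lecR; apply: le_trans (az n.+1).
by apply: ler_wpM2r; [exact: exprn_ge0|rewrite ler_nat sigma1_le].
Qed.

Definition sigma1_sum (q : C) : C := limn (series (fun n => sigma1_coef n * q ^+ n)).

Lemma sigma1_series (q : C) : `|q| < 1 ->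
  series (fun n => sigma1_coef n * q ^+ n) @ \oo --> sigma1_sum q.
Proof. exact: sigma1_series_cvg. Qed.

Lemma E2_sigma1_sum (tau : C) : `|nome tau| < 1 -> E2 tau = 1 - 24%:R * sigma1_sum (nome tau).
Proof.
move=> q1; rewrite /E2; congr (1 - _ * _).
apply: cvg_lim; first exact: norm_hausdorff.
rewrite (_ : series _ =
    [sequence series (fun n => sigma1_coef n * nome tau ^+ n) n.+1]_n); last first.
  apply/funext => n; rewrite /series /= big_nat_recl // sigma1_coef0 mul0r add0r.
  by apply: eq_bigr => i _; rewrite sigma1_coefS.
by rewrite cvg_shiftS; exact: sigma1_series.
Qed.

(** Among the indices below n, the multiples of N number n/N rounded up, which is (n + N - 1) %/
    N. *)
Lemma dilate_series N (a : nat -> C) (q : C) n : (0 < N)%N ->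
  series (fun n => dilate N a n * q ^+ n) n =
  series (fun n => a n * (q ^+ N) ^+ n) ((n + N.-1) %/ N)%N.
Proof.
move=> N0; rewrite /series /=; elim: n => [|n IHn].
  by rewrite add0n divn_small ?big_geq // prednK.
rewrite big_nat_recr //= IHn addSnnS prednK //.
rewrite (_ : (n + N) %/ N = (n %/ N).+1)%N; last by rewrite divnDr ?dvdnn // divnn N0 addn1.
rewrite /dilate.
case: ifPn => [/dvdnP[k ->]|Nn].
  by rewrite divnMDl // divn_small ?prednK // addn0 mulnK // big_nat_recr //= mulnC exprM.
rewrite mul0r addr0; congr (\sum_(0 <= i < _) _).
rewrite {1}(divn_eq n N) -addnA divnMDl // -addn1; congr (_ + _)%N.
have : (0 < n %% N)%N by rewrite lt0n.
case: (n %% N)%N (ltn_pmod n N0) => // r rN _.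
by rewrite addSnnS prednK // divnDr ?dvdnn // divnn N0 (divn_small (ltnW rN)).
Qed.

Lemma dilate_sigma1_series N (q : C) : (0 < N)%N -> `|q ^+ N| < 1 ->
  series (fun n => dilate N sigma1_coef n * q ^+ n) @ \oo --> sigma1_sum (q ^+ N).
Proof.
move=> N0 q1; rewrite (_ : series _ =
    series (fun n => sigma1_coef n * (q ^+ N) ^+ n) \o (fun n => (n + N.-1) %/ N)%N); last first.
  by apply/funext => n; rewrite /= dilate_series.
apply: cvg_comp (sigma1_series q1).
apply: (@cvg_comp _ _ _ (fun n => n + N.-1)%N (fun n => n %/ N)%N).
  exact: cvg_addnr.
exact: cvg_divnr.
Qed.

Lemma cexp0 : cexp 0 = 1 :> C.
Proof. by rewrite /cexp /= expR0 cos0 sin0 mul1r. Qed.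

Lemma cexpD (z w : C) : cexp (z + w) = cexp z * cexp w.
Proof.
case: z => a b; case: w => c d; rewrite /cexp /= expRD cosD sinD.
apply/eqP; rewrite eq_complex /=; apply/andP; split; apply/eqP; ring.
Qed.

Lemma norm_cexp (z : C) : `|cexp z| = (expR (complex.Re z))%:C.
Proof.
rewrite /cexp normrM ger0_norm ?ler0c ?expR_ge0 // normc_def /= cos2Dsin2 sqrtr1.
exact: mulr1.
Qed.

Lemma nomeM (N : nat) (tau : C) : nome (N%:R * tau) = nome tau ^+ N.
Proof.
rewrite /nome mulrCA; elim: N => [|N IHN]; first by rewrite mul0r cexp0.
by rewrite exprS -IHN -cexpD -natr1 mulrDl mul1r addrC.
Qed.

Lemma norm_nome (tau : C) : 0 < complex.Im tau -> `|nome tau| < 1.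
Proof.
case: tau => a b /= b0; rewrite /nome norm_cexp.
apply: (@lt_le_trans _ _ (1%:C : C)) => //; rewrite ltcR -[X in _ < X]expR0 ltr_expR /=.
by have := pi_gt0 R; nra.
Qed.

Lemma cvg_fin_start (u : nat -> C) (e l : C) : series u @ \oo --> l ->
  series (fun n => u n - e * (n == 0)%:R) @ \oo --> l - e.
Proof.
move=> ul; rewrite -cvg_shiftS.
rewrite (_ : [sequence _]_n = (fun n => series u n.+1 - e)).
  by apply: cvgB; [rewrite (cvg_shiftS (series u))|exact: cvg_cst].
apply/funext => n; rewrite /series /= sumrB; congr (_ - _).
rewrite big_nat_recl // mulr1 big1_seq ?addr0 // => i _.
by rewrite mulr0.
Qed.

End ComplexSeries.

(** * Eigenvalues of a matrix of prime order *)

Section FockLogDeriv.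
Context {F : numFieldType} {d : nat}.

(** Here alpha = mu = [lam i], so alpha mu^(j-1) = lam_i^j for j > 0: the character depends on the
    eigenvalues only through their power sums. *)
Lemma fock_sum_log_deriv (lam : 'I_d -> F) :
  log_deriv (fock_sum lam) (div_sum (fun j => \sum_i lam i ^+ j)).
Proof.
have ld := log_deriv_modes (fock_mode_sum_rec lam) (fock_sum_modes lam).
move=> n; rewrite ld; apply: eq_cauchyp => // k; rewrite /div_sum.
have [->|k0] := posnP k; first by rewrite !big_pred0.
apply: eq_big_seq => p; rewrite -dvdn_divisors // => pk.
congr (_ * _); apply: eq_bigr => i _; rewrite -exprS prednK // divn_gt0.
  by rewrite dvdn_leq.
exact: dvdn_gt0 pk.
Qed.

Lemma fock_sum0 (lam : 'I_d -> F) : fock_sum lam 0 = 1.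
Proof.
have fin := @fock_locally_finite d.
rewrite /fock_sum (_ : level _ 0 = [fset (mone : fock_idx d)]%fset) ?big_seq_fset1.
  by rewrite /fock_char mdom1 big_seq_fset0.
apply/fsetP => m; rewrite mem_level // in_fset1; apply/eqP/eqP => [m0|->].
  apply/eqP/cmP => x; have := fock_weight_ge m x.
  by rewrite m0 leqn0 muln_eq0 orbF cm1 => /eqP.
exact: fock_weight1.
Qed.

End FockLogDeriv.

Section PowerSums.
Context {F : numClosedFieldType}.

Lemma roots_of_unity N : (0 < N)%N -> exists rs : seq F,
  uniq rs /\ 'X^N - 1 = \prod_(z <- rs) ('X - z%:P).
Proof.
move=> N0; have [rs rsE] := closed_field_poly_normal ('X^N - 1 : {poly F}).
have lc : lead_coef ('X^N - 1 : {poly F}) = 1.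
  by apply/eqP; rewrite -monicE monicXnsubC.
rewrite lc scale1r in rsE.
exists rs; split=> //; rewrite -separable_prod_XsubC -rsE.
by rewrite separable_Xn_sub_1 // pnatr_eq0 -lt0n.
Qed.

Lemma mem_roots_of_unity N (rs : seq F) z :
  'X^N - 1 = \prod_(z <- rs) ('X - z%:P) -> (z \in rs) = (z ^+ N == 1).
Proof.
by move=> rsE; rewrite -root_prod_XsubC -rsE rootE !hornerE subr_eq0.
Qed.

Lemma size_roots_of_unity N (rs : seq F) : (0 < N)%N ->
  'X^N - 1 = \prod_(z <- rs) ('X - z%:P) -> size rs = N.
Proof.
move=> N0 /(congr1 (fun p : {poly F} => size p)).
by rewrite size_prod_XsubC size_XnsubC // => -[].
Qed.

(** If N does not divide j, some root w has w^j distinct from 1: otherwise z^j = z^N = 1 with j and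
    N coprime would make every root equal to 1. Multiplication by w permutes the roots, so the sum S
    satisfies S = w^j S. *)
Lemma sum_roots_of_unity N (rs : seq F) j : prime N -> uniq rs ->
  'X^N - 1 = \prod_(z <- rs) ('X - z%:P) ->
  \sum_(z <- rs) z ^+ j = (N * (N %| j)%N)%:R.
Proof.
move=> pN urs rsE; have N0 := prime_gt0 pN.
have memE z := mem_roots_of_unity z rsE; have sz := size_roots_of_unity N0 rsE.
case: (boolP (N %| j)%N) => [/dvdnP[q ->]|Nj].
  rewrite muln1 -[in RHS]sz -sum1_size natr_sum; apply: eq_big_seq => z.
  by rewrite memE mulnC exprM => /eqP ->; rewrite expr1n.
rewrite muln0.
have /hasP[w wrs wj] : has (fun w => w ^+ j != 1) rs.
  apply: contraT => /hasPn all1.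
  have j0 : (0 < j)%N by case: (j) Nj => //; rewrite dvdn0.
  have one z : z \in rs -> z = 1.
    move=> zrs; have := all1 z zrs; rewrite negbK => /eqP zj.
    case: (egcdnP N j0) => u v e _.
    have gcd1 : gcdn j N = 1%N by apply/eqP; rewrite -/(coprime j N) coprime_sym prime_coprime.
    have : z ^+ (u * j) = z ^+ (v * N + 1) by rewrite e gcd1.
    rewrite mulnC exprM zj expr1n exprD mulnC exprM.
    by move: zrs; rewrite memE => /eqP ->; rewrite expr1n mul1r expr1.
  have := prime_gt1 pN; rewrite -sz; case: (rs) urs one => [|x [|y t]] //= /andP[xt _] one _.
  have y1 : y = 1 by apply: one; rewrite !inE eqxx orbT.
  by case/negP: xt; rewrite (one x) ?mem_head // y1 mem_head.
have w0 : w != 0 by apply: contraTneq wrs => ->; rewrite memE expr0n gtn_eqF // eq_sym oner_eq0.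
set S := \sum_(z <- rs) _.
have SE : S = w ^+ j * S.
  rewrite {1}/S (perm_big [seq w * z | z <- rs]) /=.
    by rewrite big_map mulr_sumr; apply: eq_bigr => z _; rewrite exprMn.
  apply: uniq_perm => [||z] //; first by rewrite map_inj_uniq //; exact: mulfI.
  apply/idP/mapP => [|[x + ->]]; last first.
    by move: wrs; rewrite !memE exprMn => /eqP -> /eqP ->; rewrite mulr1.
  rewrite memE => /eqP zN; exists (w^-1 * z); last by rewrite mulrA mulfV // mul1r.
  by move: wrs; rewrite !memE exprMn exprVn zN => /eqP ->; rewrite invr1 mulr1.
apply/eqP; move/eqP: SE; rewrite -subr_eq0 -{1}[S]mul1r -mulrBl mulf_eq0 subr_eq0.
by rewrite eq_sym (negPf wj).
Qed.

Lemma char_poly_conj d (P A : 'M[F]_d) : P \in unitmx ->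
  char_poly (invmx P *m A *m P) = char_poly A.
Proof.
move=> uP; rewrite /char_poly /char_poly_mx.
have uPX : map_mx polyC P \in unitmx by rewrite map_unitmx.
have -> : 'X%:M - map_mx polyC (invmx P *m A *m P) =
    invmx (map_mx polyC P) *m ('X%:M - map_mx polyC A) *m map_mx polyC P.
  rewrite mulmxBr mulmxBl !map_mxM map_invmx; congr (_ - _).
  by rewrite mul_mx_scalar -scalemxAl mulVmx // scalemx1.
rewrite !det_mulmx mulrC mulrA -det_mulmx mulmxV // det1 mul1r //.
Qed.

(* [G] is diagonalisable because its minimal polynomial divides 'X^N - 1, whose
   roots are simple. *)
Lemma finite_order_diag d (G : 'M[F]_d) N q r : prime N -> (r <= q)%N ->
  G ^+ N = 1%:M -> char_poly G = ('X^N - 1) ^+ q %/ ('X - 1) ^+ r ->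
  exists (P : 'M[F]_d) (lam : 'rV[F]_d),
    [/\ P \in unitmx, G = invmx P *m diag_mx lam *m P &
     forall j, \sum_i lam 0 i ^+ j + r%:R = (q * (N * (N %| j)%N))%:R].
Proof.
move=> pN rq GN cG; have N0 := prime_gt0 pN.
have [rs [urs rsE]] := roots_of_unity N0.
have [P [lam [uP GE]]] : exists (P : 'M[F]_d) (lam : 'rV[F]_d),
    P \in unitmx /\ G = invmx P *m diag_mx lam *m P.
  case: d G GN cG => [|d] G GN cG.
    exists 1%:M, 0; rewrite unitmx1; split=> //.
    by apply/matrixP => -[].
  have [_ /(_ _)[]] := diagonalizableP G.
    exists rs => //; apply: mxminpoly_min; rewrite -rsE rmorphB rmorphXn /=.
    by rewrite horner_mx_X rmorph1 GN subrr.
  move=> P uP /(similar_diagLR uP)[D GE]; exists P, D; split=> //.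
  by rewrite GE conjVmx.
exists P, lam; split=> // j.
(* The eigenvalues together with r extra 1's are q copies of the N-th roots of unity. The division
   in the characteristic polynomial is exact since r <= q. *)
have : perm_eq ([seq lam 0 i | i <- index_enum 'I_d] ++ nseq r 1)
               (flatten (nseq q rs)).
  apply: prod_XsubC_eq; rewrite big_cat big_map /= big_nseq iter_mulr_1.
  have -> : \prod_i ('X - (lam 0 i)%:P) = char_poly G.
    rewrite GE char_poly_conj // char_poly_trig; last exact: diag_mx_is_trig.
    by apply: eq_bigr => i _; rewrite mxE eqxx.
  have dv : ('X - 1 : {poly F}) %| 'X^N - 1.
    by rewrite -[1]/(1%:P) dvdp_XsubCl rootE !hornerE expr1n subrr.
  rewrite cG polyC1 divpK; last first.
    by apply: dvdp_trans (dvdp_exp2l _ rq) _; exact: dvdp_exp2r.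
  rewrite rsE big_flatten; elim: (q) => [|k IHk]; first by rewrite expr0 big_nil.
  by rewrite exprS /= big_cons IHk.
move=> eq_roots.
have : \sum_(z <- [seq lam 0 i | i <- index_enum 'I_d] ++ nseq r 1) z ^+ j =
    \sum_(z <- flatten (nseq q rs)) z ^+ j by exact: perm_big.
rewrite big_cat big_map /=.
rewrite big_nseq.
rewrite iter_addr_0 expr1n.
move=> ->; rewrite big_flatten.
elim: (q) => [|k IHk]; first by rewrite big_nil.
by rewrite /= big_cons IHk (sum_roots_of_unity j pN urs rsE) mulSn natrD.
Qed.

End PowerSums.

Lemma diag_conj_pow (F : fieldType) d (P : 'M[F]_d) (lam : 'rV[F]_d) k : P \in unitmx ->
  (invmx P *m diag_mx lam *m P) ^+ k = invmx P *m diag_mx (\row_i lam 0 i ^+ k) *m P.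
Proof.
move=> uP; elim: k => [|k IHk].
  rewrite expr0 (_ : \row_i _ = const_mx 1) ?diag_const_mx ?mulmx1 ?mulVmx //.
  by apply/rowP => i; rewrite !mxE expr0.
rewrite exprS IHk -mulmxE !mulmxA mulmxK // -(mulmxA (invmx P)) mulmx_diag.
by congr (_ *m diag_mx _ *m _); apply/rowP => i; rewrite !mxE exprS.
Qed.

(** For a divisor p of n, N divides n/p exactly when pN divides n, that is, when N divides n and p
    divides n/N. *)
Lemma div_sum_dvdn (F : comNzRingType) N n : (0 < N)%N ->
  div_sum (fun j => (N %| j)%:R) n = dilate N (div_sum (fun=> 1)) n :> F.
Proof.
move=> N0; have [->|n0] := posnP n; first by rewrite /dilate dvdn0 div0n !div_sum0.
rewrite /div_sum n0 (@big_divisors _ _ n) ?n0 ?leqnn // /dilate.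
have dvdE p : (0 < p)%N -> (p %| n)%N && (N %| n %/ p)%N = (N %| n)%N && (p %| n %/ N)%N.
  move=> p0; have half a b : (0 < a)%N -> (a %| n)%N && (b %| n %/ a)%N = (a * b %| n)%N.
    move=> a0; apply/andP/idP => [[an]|abn]; first by rewrite dvdn_divRL // mulnC.
    have an : (a %| n)%N by apply: dvdn_trans abn; exact: dvdn_mulr.
    by rewrite an dvdn_divRL // mulnC.
  by rewrite !half // mulnC.
case: ifPn => Nn; last first.
  rewrite big1 // => l _; case: ifP => // ln.
  have := dvdE l.+1 isT; rewrite ln (negPf Nn) /= => ->.
  by rewrite mulr0.
have nN0 : (0 < n %/ N)%N by rewrite divn_gt0 // dvdn_leq.
rewrite nN0 (@big_divisors _ _ n) ?nN0 ?leq_div //.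
apply: eq_bigr => l _; have := dvdE l.+1 isT; rewrite Nn /= => <-.
by case: ifP => //= _; case: ifP; rewrite ?mulr0 ?mulr1.
Qed.

Lemma div_sumD (F : comNzRingType) (f g : nat -> F) n :
  div_sum (fun j => f j + g j) n = div_sum f n + div_sum g n.
Proof. by rewrite /div_sum -big_split; apply: eq_bigr => p _; rewrite mulrDr. Qed.

Lemma div_sumZ (F : comNzRingType) (c : F) (f : nat -> F) n :
  div_sum (fun j => c * f j) n = c * div_sum f n.
Proof. by rewrite /div_sum mulr_sumr; apply: eq_bigr => p _; rewrite mulrCA. Qed.

Lemma eq_div_sum (F : comNzRingType) (f g : nat -> F) : f =1 g -> div_sum f =1 div_sum g.
Proof. by move=> fg n; apply: eq_bigr => p _; rewrite fg. Qed.

(** * The twisted module *)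

Lemma mulr_sum3 (F : comNzRingType) (I J K : Type) (r : seq I) (s : seq J) (t : seq K)
    (c : F) (a : I -> F) (b : J -> F) (e : K -> F) :
  c * (\sum_(i <- r) a i) * (\sum_(j <- s) b j) * (\sum_(k <- t) e k) =
  \sum_(i <- r) \sum_(j <- s) \sum_(k <- t) c * a i * b j * e k.
Proof.
apply/esym; under eq_bigr => i _ do under eq_bigr => j _ do rewrite -mulr_sumr.
under eq_bigr => i _ do rewrite -mulr_suml -mulr_sumr.
by rewrite -!mulr_suml -mulr_sumr.
Qed.

Section TwistedW.
Context {F : numFieldType} {d M r e : nat}.
Hypotheses (dE : d = (24 * e)%N) (dM : (d + r)%N = M).
Local Notation W := (Wtw F d M r).
Local Notation K := (tw_idx d M r).
Implicit Types (k : K) (w : W) (G H : 'M[F]_d) (s t : 'S_M) (n : nat).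

(** The eigenvalue of L(0) - c/24 on a basis vector, once the ground energy has cancelled against
    c/24. *)
Definition tot_weight : K -> nat :=
  wt_pair (wt_pair (@fock_weight d) (@tw_weight 'I_M)) (@fock_weight r).

(* The labels (m, eps) of the joint eigenspaces. *)
Definition label (k : K) : int * bool :=
  ((fock_weight k.1.1)%:Z - e%:Z, odd (tw_size k.1.2)).

Lemma tot_weight_finite : locally_finite tot_weight.
Proof.
apply: locally_finite_pair; last exact: fock_locally_finite.
by apply: locally_finite_pair; [exact: fock_locally_finite|exact: tw_locally_finite].
Qed.

Lemma fock_deg_ket p (m : fock_idx p) :
  fock_deg (ket m) = (fock_weight m)%:R *: ket m :> malg (fock_idx p) F.
Proof. exact: lext_ket. Qed.

Lemma L1_ket k : L1 (ket k) = (fock_weight k.1.1)%:R *: ket k :> W.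
Proof.
apply: (tensl_diag (c := fun x => (fock_weight x.1)%:R)) => x.
exact: (tensl_diag (c := fun m => (fock_weight m)%:R) (@fock_deg_ket d)).
Qed.

Lemma L2_ket k : L2 (ket k) = (M%:R / 16%:R + (tw_weight k.1.2)%:R) *: ket k :> W.
Proof.
apply: (tensl_diag (c := fun x => M%:R / 16%:R + (tw_weight x.2)%:R)) => x.
exact: (tensr_diag (c := fun f => M%:R / 16%:R + (tw_weight f)%:R) tw_L0_ket).
Qed.

Lemma L3_ket k : L3 (ket k) = (fock_weight k.2)%:R *: ket k :> W.
Proof. exact: (tensr_diag (c := fun m => (fock_weight m)%:R) (@fock_deg_ket r)). Qed.

Lemma ptilde_ket k : ptilde (ket k) = (-1) ^+ tw_size k.1.2 *: ket k :> W.
Proof.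
apply: (tensl_diag (c := fun x => (-1) ^+ tw_size x.2)) => x.
exact: (tensr_diag (c := fun f => (-1) ^+ tw_size f) tw_ptilde_ket).
Qed.

Lemma L1_linear : linear (@L1 F d M r).
Proof. exact: (tensl_linear (tensl _)). Qed.

Lemma ptilde_linear : linear (@ptilde F d M r).
Proof. exact: (tensl_linear (tensr _)). Qed.

HB.instance Definition _ := GRing.isLinear.Build F W W _ (@L1 F d M r) L1_linear.
HB.instance Definition _ := GRing.isLinear.Build F W W _ (@ptilde F d M r) ptilde_linear.

Lemma L1_diag : diag_op (fun k => (fock_weight k.1.1)%:R) (@L1 F d M r).
Proof. exact: (diag_opP (T := @L1 F d M r) L1_ket). Qed.

Lemma ptilde_diag : diag_op (fun k => (-1) ^+ tw_size k.1.2) (@ptilde F d M r).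
Proof. exact: (diag_opP (T := @ptilde F d M r) ptilde_ket). Qed.

Lemma L0_diag : diag_op (fun k => M%:R / 16%:R + (tot_weight k)%:R) (@L0 F d M r).
Proof.
have L2d : diag_op (fun k => M%:R / 16%:R + (tw_weight k.1.2)%:R) (@L2 F d M r).
  exact: (diag_opP (T := tensl (tensr (@tw_L0 F M))) L2_ket).
have L3d : diag_op (fun k => (fock_weight k.2)%:R) (@L3 F d M r).
  exact: (diag_opP (T := tensr (@fock_deg F r)) L3_ket).
have L123 := diag_opD (diag_opD L1_diag L2d) L3d.
move=> w k; apply: etrans (L123 w k) _; congr (_ * _).
by rewrite /tot_weight /wt_pair /= !natrD; ring.
Qed.

Lemma c1E : @c1 F d / 24%:R = e%:R :> F.
Proof.
by rewrite /c1 dE natrM mulrC mulrA mulVf ?mul1r // pnatr_eq0.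
Qed.

(** c = d + r + M/2 = 3M/2, and c/24 is then the ground energy 1/16 of each of the M twisted
    factors. *)
Lemma ccE : @cc F d M r / 24%:R = M%:R / 16%:R.
Proof.
rewrite /cc /c1 /c2 /c3 addrAC -natrD dM.
by field.
Qed.

Lemma span_on_iff (P Q : K -> Prop) w : (forall k, P k <-> Q k) ->
  span_on (F := F) P w <-> span_on Q w.
Proof. by move=> PQ; split=> wP k /wP /PQ. Qed.

Lemma WnE n : @Wn F d M r n = span_on (fun k => tot_weight k = n).
Proof.
have dL0 := diag_opB (@cc F d M r / 24%:R) L0_diag.
have iff k : M%:R / 16%:R + (tot_weight k)%:R - @cc F d M r / 24%:R = n%:R <->
    tot_weight k = n.
  rewrite ccE addrAC subrr add0r; split=> [/eqP|-> //].
  by rewrite eqr_nat => /eqP.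
apply/seteqP; split=> w.
  by move/(diag_op_eigen n%:R w dL0)/(span_on_iff w iff).
by move/(span_on_iff w iff)/(diag_op_eigen n%:R w dL0).
Qed.

Lemma WnmeE n x : @Wnme F d M r n x = span_on (fun k => tot_weight k = n /\ label k = x).
Proof.
have dL1 := diag_opB (@c1 F d / 24%:R) L1_diag.
have iff1 k : (fock_weight k.1.1)%:R - @c1 F d / 24%:R = x.1%:~R <-> (label k).1 = x.1.
  rewrite c1E /label /= -[X in X <-> _]/(_ = _ :> F).
  rewrite -[X in X - _]/((fock_weight k.1.1)%:Z%:~R) -[X in _ - X]/(e%:Z%:~R) -intrB.
  by split=> [/eqP|-> //]; rewrite eqr_int => /eqP.
have iffp k : (-1) ^+ tw_size k.1.2 = (-1) ^+ x.2 :> F <-> (label k).2 = x.2.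
    rewrite -[X in X = _ <-> _]signr_odd /label /=.
  by split=> [/signr_inj|->].
have x_eq k : label k = x <-> (label k).1 = x.1 /\ (label k).2 = x.2.
  split=> [->//|[]]; case: x {iff1 iffp} => a b; case: (label k) => a' b' /=.
  by move=> -> ->.
apply/seteqP; split=> w.
  case; rewrite WnE => wn.
  move=> /(diag_op_eigen _ w dL1)/(span_on_iff w iff1) w1.
  move=> /(diag_op_eigen _ w ptilde_diag)/(span_on_iff w iffp) wp k kw.
  by split; [exact: wn|apply/x_eq; split; [exact: w1|exact: wp]].
move=> wP; split.
- by rewrite WnE => k /wP[].
- apply/(diag_op_eigen _ w dL1)/(span_on_iff w iff1) => k /wP[_].
  by move/x_eq => [].
apply/(diag_op_eigen _ w ptilde_diag)/(span_on_iff w iffp) => k /wP[_].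
by move/x_eq => [].
Qed.

Lemma gs_linear G s : linear (@gs F d M r G s).
Proof. exact: (tens12_linear (fock_map G) (tw_perm s)). Qed.

HB.instance Definition _ G s := GRing.isLinear.Build F W W _ (@gs F d M r G s) (gs_linear G s).

Lemma gs_comp G H s t w : gs G s (gs H t w) = gs (H *m G) (t * s)%g w.
Proof.
apply: (etrans (tens12_comp (fock_map G) (tw_perm s) (fock_map H) (tw_perm t) w)).
exact: (eq_tens12 (fock_map_comp G H) (tw_perm_comp t s) w).
Qed.

Lemma gs1 w : gs 1%:M 1%g w = w.
Proof.
apply: (etrans _ (tens12_id w)).
exact: (eq_tens12 fock_map_id tw_perm1 w).
Qed.

Lemma iter_gs G s n w : iter n (gs G s) w = gs (G ^+ n) (s ^+ n)%g w.
Proof.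
elim: n => [|n IHn]; first by rewrite expr0 expg0 gs1.
have eG : G ^+ n.+1 = G ^+ n *m G := exprSr G n.
by rewrite iterS IHn eG expgSr; exact: gs_comp.
Qed.

Lemma gs_ket G s m f u : gs G s (ket (m, f, u)) =
  koszul s (sizes f) *:
    lext (fun x => ket (x, perm_ffun s f, u) : W) (fock_map G (ket m)).
Proof. exact: (tens12_ket (fock_map G) (S := tw_perm s) m u (tw_perm_ket s f)). Qed.

Lemma gs_ket_span G s k n x :
  tot_weight k = n /\ label k = x ->
  span_on (fun k => tot_weight k = n /\ label k = x) (gs G s (ket k)).
Proof.
case: k => -[m f] u kP; rewrite gs_ket; apply: span_onZ.
apply: span_on_lext => m'; rewrite fock_map_ket => /fock_mono_homog m'm.
apply/span_on_ket; move: kP; rewrite /tot_weight /label /wt_pair /=.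
by rewrite m'm tw_weight_perm tw_size_perm.
Qed.

(** Gamma moves only the first label, sigma permutes the second up to a sign and the third is
    untouched, so the diagonal coefficient factors. *)
Lemma gs_diag_coeff G s m f u :
  mcoeff (m, f, u) (@gs F d M r G s (ket (m, f, u))) =
  mcoeff m (fock_map G (ket m)) * ((perm_ffun s f == f)%:R * koszul s (sizes f)).
Proof. by rewrite gs_ket mcoeffZ mcoeff_lext_triple (eqxx u) mulr1; ring. Qed.

(** The common value of [virtual_trace] and [weighted_trace] at a power of gamma sigma, as a sum of
    diagonal coefficients. *)
Definition weighted_sum G s n : F := \sum_(k <- level tot_weight n)
  ((fock_weight k.1.1)%:R - e%:R) * (-1) ^+ tw_size k.1.2 * mcoeff k (gs G s (ket k)).

Lemma weighted_sum_cauchyp G s n : weighted_sum G s n =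
  cauchyp (fun i => (i%:R - e%:R) *
          \sum_(m <- level (@fock_weight d) i) mcoeff m (fock_map G (ket m)))
       (cauchyp (perm_sum s) (fock_sum (fun _ : 'I_r => 1))) n.
Proof.
have fd := @fock_locally_finite d; have fr := @fock_locally_finite r.
have ft := @tw_locally_finite 'I_M.
rewrite cauchypA /weighted_sum /tot_weight big_level_pair //; last exact: locally_finite_pair.
apply: eq_bigr => i _; rewrite big_level_pair //.
under eq_bigr => j _ do under eq_bigr => m _ do under eq_bigr => f _ do
  under eq_bigr => u _ do rewrite gs_diag_coeff /=.
rewrite /cauchyp mulr_suml; apply: eq_bigr => j _; rewrite /perm_sum /fock_sum mulr_sum3.
rewrite big_seq [RHS]big_seq; apply: eq_bigr => m; rewrite mem_level // => /eqP mj.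
apply: eq_bigr => f _; apply: eq_bigr => u _.
rewrite mj /fock_char [X in _ = _ * X]big1 ?mulr1 => [|x _]; last by rewrite expr1n.
by ring.
Qed.

Lemma trace_on_Wn G s n : trace_on (@Wn F d M r n)
    (fun w => gs G s (ptilde (L1 w - (@c1 F d / 24%:R) *: w))) = weighted_sum G s n.
Proof.
have fin := tot_weight_finite.
have Tket k : gs G s (ptilde (L1 (ket k) - (@c1 F d / 24%:R) *: ket k)) =
    (((fock_weight k.1.1)%:R - e%:R) * (-1) ^+ tw_size k.1.2) *: gs G s (ket k).
  by rewrite c1E (shifted_comp_ket _ _ (ptilde_ket k) (L1_ket k)).
rewrite WnE (@trace_on_span _ _ _ (level tot_weight n)).
- by apply: eq_bigr => k _; rewrite Tket mcoeffZ.
- exact: shifted_comp_linear.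
- exact: fset_uniq.
- by move=> k; rewrite mem_level //; split=> /eqP.
- move=> k kn; rewrite Tket; apply: span_onZ => k' k'k.
  by have [] := gs_ket_span (conj kn erefl) k'k.
Qed.

Lemma sum_trace_on_Wnme G s n :
  \sum_(x \in [set: int * bool])
    (-1) ^+ x.2 * x.1%:~R * trace_on (@Wnme F d M r n x) (gs G s) = weighted_sum G s n.
Proof.
have fin := tot_weight_finite; pose E := level tot_weight n.
have trE x : trace_on (@Wnme F d M r n x) (gs G s) =
    \sum_(k <- E | label k == x) mcoeff k (gs G s (ket k)).
  rewrite WnmeE (@trace_on_span _ _ _ [seq k <- E | label k == x]).
  - by rewrite big_filter.
  - exact: gs_linear.
  - by rewrite filter_uniq // fset_uniq.
  - move=> k; rewrite mem_filter mem_level //; split; first by case=> -> ->; rewrite !eqxx.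
    by case/andP => /eqP -> /eqP ->.
  - by move=> k; exact: gs_ket_span.
(* Only the finitely many labels met in level n give a nonzero eigenspace. *)
rewrite (fsbigE (enum_fset [fset label k | k in E]%fset)); first last.
- move=> x _ xE; rewrite trE big_seq_cond big_pred0 ?mulr0 // => k.
  apply: contraNF xE => /andP[kE /eqP <-]; apply/imfsetP; by exists k.
- by [].
- exact: fset_uniq.
rewrite /weighted_sum (partition_big_imfset _ label) /=.
apply: eq_big => [x|x _]; first by rewrite in_setT.
rewrite trE mulr_sumr; apply: eq_bigr => k /eqP <-.
by rewrite /label /= signr_odd intrB; ring.
Qed.

Lemma Wn_direct_sum : direct_sum [set: W] (@Wn F d M r).
Proof.
have -> : [set: W] = span_on (fun=> True) by apply/seteqP; split=> // w _ k _.
rewrite (_ : @Wn F d M r = fun n => span_on (fun k => True /\ tot_weight k = n)).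
  exact: direct_sum_span.
apply/funext => n; rewrite WnE; congr span_on; apply/funext => k.
by apply/propext; split=> [|[]].
Qed.

Lemma Wnme_direct_sum n : direct_sum (@Wn F d M r n) (@Wnme F d M r n).
Proof.
rewrite WnE (_ : @Wnme F d M r n =
    fun x => span_on (fun k => tot_weight k = n /\ label k = x)).
  exact: direct_sum_span.
by apply/funext => x; exact: WnmeE.
Qed.

Lemma Wn_findim n : findim (@Wn F d M r n).
Proof.
rewrite WnE; apply: (findim_span (E := level tot_weight n)); first exact: fset_uniq.
by move=> k; rewrite mem_level; [split=> /eqP|exact: tot_weight_finite].
Qed.

Lemma Wnme_findim n x : findim (@Wnme F d M r n x).
Proof.
rewrite WnmeE; apply: (findim_span (E := [seq k <- level tot_weight n | label k == x])).
  by rewrite filter_uniq // fset_uniq.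
move=> k; rewrite mem_filter mem_level; last exact: tot_weight_finite.
by split=> [[-> ->]|/andP[/eqP -> /eqP ->]]; rewrite ?eqxx.
Qed.

Lemma Wnme_finite n :
  finite_set [set x | exists2 w, @Wnme F d M r n x w & w != 0].
Proof.
apply: (sub_finite_set (B := [set label k | k in [set k | tot_weight k = n]])).
  move=> x [w]; rewrite WnmeE => wx w0.
  have [w'|[k /wx[kn kx]]] := fset_0Vmem (msupp w); last by exists k.
  by move: w0; rewrite [w]malg_ket w' big_seq_fset0 eqxx.
exact/finite_image/tot_weight_finite.
Qed.

Lemma Wnme_stable G s n x w : @Wnme F d M r n x w -> @Wnme F d M r n x (gs G s w).
Proof.
rewrite WnmeE => wx; rewrite (lextE (gs G s)).
by apply: span_on_lext => k /wx; exact: gs_ket_span.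
Qed.

Lemma W_not_findim : (0 < d)%N -> ~ findim [set: W].
Proof.
move=> d0; pose i : 'I_d := Ordinal d0.
pose E n : K := (ucm (i, n), [ffun=> fset0], mone).
apply: (infinite_not_findim (E := E)) => n1 n2 [].
by move/(congr1 (@fock_weight d)); rewrite !fock_weightU /= => -[].
Qed.

(** * The action of the cyclic group *)

Section CyclicAction.
Variables (N : nat) (G : 'M[F]_d) (s : 'S_M).
Hypotheses (pN : prime N) (GN : G ^+ N = 1%:M) (sN : (s ^+ N = 1)%g).

Let N_gt0 : (0 < N)%N := prime_gt0 pN.

Lemma invmx_pow : invmx G = G ^+ N.-1.
Proof.
have GG : G *m G ^+ N.-1 = 1%:M by rewrite mulmxE -exprS prednK.
have [uG _] := mulmx1_unit GG.
by rewrite -[LHS]mulmx1 -GG mulmxA mulVmx // mul1mx.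
Qed.

Lemma invg_pow : (s^-1 = s ^+ N.-1)%g.
Proof. by apply/eqP; rewrite eq_invg_mul -expgS prednK // sN. Qed.

(** The inverse is the power N - 1, so the exponent -(n+1) becomes (N - 1)(n + 1); divisibility by N
    is unaffected because N - 1 is coprime to N. *)
Lemma gs_powE (k : int) : exists j, (N %| j)%N = (N %| k)%Z /\
  @gs_pow F d M r G s k = gs (G ^+ j) (s ^+ j)%g.
Proof.
case: k => n.
  by exists n; split=> //; apply/funext => w; rewrite /gs_pow iter_gs.
exists (N.-1 * n.+1)%N; split.
  rewrite dvdzE /= Gauss_dvdr //.
  by rewrite -[X in coprime X _](prednK N_gt0) coprimeSn.
apply/funext => w; rewrite /gs_pow /gs_inv invmx_pow invg_pow iter_gs.
by rewrite exprM expgM.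
Qed.

Lemma gs_virtual_graded_module : virtual_graded_module (r := r) N G s.
Proof.
have GG : G *m invmx G = 1%:M by rewrite invmx_pow mulmxE -exprS prednK.
have GG' : invmx G *m G = 1%:M by rewrite invmx_pow mulmxE -exprSr prednK.
split; split.
- exact: gs_linear.
- by move=> w; rewrite /gs_inv gs_comp GG mulgV gs1.
- by move=> w; rewrite /gs_inv gs_comp GG' mulVg gs1.
- by move=> w; rewrite iter_gs GN sN gs1.
- exact: Wn_direct_sum.
- exact: Wn_findim.
- exact: Wnme_direct_sum.
- exact: Wnme_finite.
- by move=> n x; split; [exact: Wnme_findim|move=> w; exact: Wnme_stable].
Qed.

End CyclicAction.
End TwistedW.

(** * The characters *)

Section ModuleCharacters.
Context {F : numClosedFieldType} {d M r e N : nat}.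
Variables (G : 'M[F]_d) (s : 'S_M).
Hypotheses (dE : d = (24 * e)%N) (dM : (d + r)%N = M) (pN : prime N).
Hypotheses (rM : (r <= M %/ N)%N) (GN : G ^+ N = 1%:M).
Hypothesis cG : char_poly G = ('X^N - 1) ^+ (M %/ N) %/ ('X - 1) ^+ r.
Hypothesis sN : cycle_shape s N (M %/ N).

Local Notation sigma1_coef := (@div_sum F (fun=> 1)).

(** The eigenvalues of [G ^+ j] have p-th power sum M[N | jp] - r. This is M - r = 24e if N divides
    j, and M[N | p] - r otherwise, by primality of N. *)
Lemma weighted_sum_pow j n :
  weighted_sum (r := r) (e := e) (G ^+ j) (s ^+ j)%g n =
  (if (N %| j)%N then (24 * e)%:R * sigma1_coef n
   else M%:R * dilate N sigma1_coef n - r%:R * sigma1_coef n)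
  - e%:R * (n == 0)%:R.
Proof.
have N0 := prime_gt0 pN.
have [P [lam [uP GE powsum]]] := finite_order_diag pN rM GN cG.
have ME : M = (N * (M %/ N))%N := cycle_shape_card sN.
have GjE : G ^+ j = invmx P *m diag_mx (\row_i lam 0 i ^+ j) *m P.
  by rewrite GE diag_conj_pow.
set a := fock_sum (fun i => (\row_i lam 0 i ^+ j) 0 i).
set t := fun n => if (N %| j)%N then - (M%:R * sigma1_coef n)
                  else - (M%:R * dilate N sigma1_coef n).
have ld_a : log_deriv a (fun n => if (N %| j)%N then (24 * e)%:R * sigma1_coef n
    else M%:R * dilate N sigma1_coef n - r%:R * sigma1_coef n).
  move=> i; rewrite (fock_sum_log_deriv _ i); apply: eq_cauchyp => // l.
  have tauE p : \sum_i (\row_i lam 0 i ^+ j) 0 i ^+ p =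
      (if (N %| j)%N then (24 * e)%:R else M%:R * (N %| p)%:R - r%:R) :> F.
    under eq_bigr do rewrite mxE -exprM.
    apply: (addIr r%:R); rewrite powsum mulnA [(_ %/ _ * N)%N]mulnC -ME.
    case: ifP => Nj; first by rewrite dvdn_mulr // muln1 -dE -natrD dM.
    by rewrite Euclid_dvdM // Nj /= natrM subrK.
  rewrite (eq_div_sum tauE); case: ifP => Nj.
    by rewrite -div_sumZ; apply: eq_div_sum => p; rewrite mulr1.
  rewrite -div_sum_dvdn // -mulNr -!div_sumZ -div_sumD.
  by apply: eq_div_sum => p; rewrite mulr1.
(* If N divides j then s^j = 1 and all M factors count; otherwise the M/N cycles count, and the
   chain rule restores the factor N. *)
have ld_b : log_deriv (@perm_sum F M (s ^+ j)%g) t.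
  rewrite /t; case: (boolP (N %| j)%N) => [/dvdnP[q jq]|Nj].
    have -> : (s ^+ j = 1)%g by rewrite jq mulnC expgM (cycle_shape_expgN sN) expg1n.
    move=> i; rewrite perm_sum1 (@tw_sum_log_deriv F 'I_M i) card_ord.
    apply: eq_cauchyp => [l|l]; last by rewrite perm_sum1.
    by rewrite -mulNr -div_sumZ; apply: eq_div_sum => p; rewrite mulr1.
  move=> i; rewrite (perm_sum_log_deriv pN sN Nj i); apply: eq_cauchyp => // l.
  rewrite /dilate; case: ifP => _; last by rewrite !mulr0 oppr0.
  rewrite -mulNr -!div_sumZ; apply: eq_div_sum => p.
  by rewrite mulr1 {2}ME natrM mulrN.
have ld_c : log_deriv (@fock_sum F r (fun=> 1)) (fun n => r%:R * sigma1_coef n).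
  move=> i; rewrite (fock_sum_log_deriv _ i); apply: eq_cauchyp => // l.
  rewrite -div_sumZ; apply: eq_div_sum => p; rewrite mulr1.
  by under eq_bigr do rewrite expr1n; rewrite sumr_const card_ord.
have b0 : @perm_sum F M (s ^+ j)%g 0 = 1.
  have [/dvdnP[q jq]|Nj] := boolP (N %| j)%N.
    have -> : (s ^+ j = 1)%g by rewrite jq mulnC expgM (cycle_shape_expgN sN) expg1n.
    by rewrite perm_sum1 tw_sum0.
  by rewrite (perm_sum_cycle pN sN Nj) /dilate dvdn0 div0n tw_sum0.
rewrite weighted_sum_cauchyp.
rewrite -(weighted_cauchyp e%:R (fock_sum0 _) b0 (fock_sum0 _) ld_a ld_b ld_c).
  apply: eq_cauchyp => // i; congr (_ * _).
  exact: fock_trace_similar uP GjE.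
move=> i; rewrite /t; case: ifP => _; last by ring.
by rewrite -{1}dE -dM natrD; ring.
Qed.

End ModuleCharacters.

(** * Arithmetic of the constants *)

Lemma dvdn_24_sqr_prime N : prime N -> (3 < N)%N -> (24 %| N ^ 2 - 1)%N.
Proof.
move=> pN N3; pose r := (N %% 24)%N.
have prime_ndvd p : prime p -> (p <= 3)%N -> ~~ (p %| N)%N.
  move=> pp p3; rewrite dvdn_prime2 //; apply: contraTneq p3 => ->.
  by rewrite -ltnNge.
have r2 : (r %% 2 != 0)%N by rewrite modn_dvdm // prime_ndvd.
have r3 : (r %% 3 != 0)%N by rewrite modn_dvdm // prime_ndvd.
(* Every residue modulo 24 that is prime to 6 has square 1. *)
have /allP/(_ r) : all (fun r => (r %% 2 != 0) && (r %% 3 != 0) ==> (r ^ 2 %% 24 == 1))%N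
    (iota 0 24) by vm_compute.
rewrite mem_iota ltn_pmod // => /(_ isT); rewrite r2 r3 /= modnXm => /eqP N1.
by rewrite -eqn_mod_dvd ?expn_gt0 ?prime_gt0 // N1.
Qed.

(** The three cases of (M, r) obey the same relations 24 ell_N = r (N^2 - 1) and M = r N^2, for
    instance 24 = 8 * 3 and 32 = 8 * 4 when N = 2; no case distinction is needed afterwards. *)
Lemma ell_spec N : prime N ->
  [/\ (24 * ell N = rk N * (N ^ 2 - 1))%N, bigM N = (rk N * N ^ 2)%N,
      (rk N <= bigM N %/ N)%N & (0 < ell N)%N].
Proof.
move=> pN; have [->|N2] := eqVneq N 2%N.
  by have -> : ell 2 = 1%N by rewrite /ell; vm_compute.
have [->|N3] := eqVneq N 3%N.
  by have -> : ell 3 = 1%N by rewrite /ell; vm_compute.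
have N4 : (3 < N)%N.
  by case: N pN N2 N3 => [|[|[|[|N]]]].
have /dvdnP[k kE] := dvdn_24_sqr_prime pN N4.
have -> : ell N = k.
  rewrite /ell kE PoszM intrM mulfK; first by rewrite numq_int.
  by rewrite intr_eq0.
rewrite /bigM /rk (negPf N2) (negPf N3) kE !mul1n mulnC; split=> //.
  by rewrite -mulnn mulnK ?prime_gt0.
rewrite lt0n; apply: contra_eq_neq kE => ->; rewrite mul0n subn_eq0 -ltnNge.
by rewrite -mulnn; apply: leq_trans (leq_mul (ltnW N4) (ltnW N4)).
Qed.

(** Used with D = N^2 - 1, e = ell_N, and S, S' the sums of sigma_1(n) q^n at q and at q^N. *)
Lemma E2N_combination (F : numFieldType) (D e r S S' : F) : D != 0 -> 24%:R * e = r * D ->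
  - e * (((D + 1) * (1 - 24%:R * S') - (1 - 24%:R * S)) / D) =
  r * (D + 1) * S' - r * S - e.
Proof.
move=> D0 eE; have -> : e = r * D / 24%:R by rewrite -eE mulrAC mulfV ?mul1r // pnatr_eq0.
by field.
Qed.

(** * Convergence to the Eisenstein series *)

Section Limit.
Context {R : realType}.
Local Notation C := (Cplx R).

Lemma cvg_seriesZ (c : C) (u : nat -> C) (l : C) :
  series u @ \oo --> l -> series (fun n => c * u n) @ \oo --> c * l.
Proof.
move=> ul; rewrite (_ : series _ = (fun n => c * series u n)); first exact: cvgMl_tmp.
by apply/funext => n; rewrite /series /= mulr_sumr.
Qed.

Lemma cvg_seriesB (u v : nat -> C) (l m : C) :
  series u @ \oo --> l -> series v @ \oo --> m ->
  series (fun n => u n - v n) @ \oo --> l - m.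
Proof.
move=> ul vm; have uv := cvgB ul vm.
rewrite (_ : series _ = (fun n => series u n - series v n)).
  exact: uv.
by apply/funext => n; rewrite /series /= sumrB.
Qed.

Lemma character_cvg N (b : bool) (tau : C) : prime N -> 0 < complex.Im tau ->
  series (fun n =>
    ((if b then (24 * ell N)%:R * sigma1_coef n
      else (bigM N)%:R * dilate N sigma1_coef n - (rk N)%:R * sigma1_coef n)
     - (ell N)%:R * (n == 0)%:R) * nome tau ^+ n) @ \oo --> Fg N b tau.
Proof.
move=> pN tau0; have [ellE bigE _ _] := ell_spec pN; have N0 := prime_gt0 pN.
set q := nome tau; have q1 : `|q| < 1 by exact: norm_nome.
have qN1 : `|q ^+ N| < 1 by rewrite normrX exprn_ilt1 // -lt0n.
pose u n := (if b then (24 * ell N)%:R * (sigma1_coef n * q ^+ n)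
  else (bigM N)%:R * (dilate N sigma1_coef n * q ^+ n) - (rk N)%:R * (sigma1_coef n * q ^+ n)) : C.
rewrite (_ : (fun n => _) = (fun n => u n - (ell N)%:R * (n == 0)%:R)); last first.
  apply/funext => n; rewrite /u mulrBl -[X in _ - X]mulrA.
  congr (_ - _ * _); first by case: b {u} => //; ring.
  by case: n => [|n]; rewrite ?expr0 ?mulr1 // mul0r.
have -> : Fg N b tau = (if b then (24 * ell N)%:R * sigma1_sum q
    else (bigM N)%:R * sigma1_sum (q ^+ N) - (rk N)%:R * sigma1_sum q) - (ell N)%:R.
  rewrite /Fg /E2N !E2_sigma1_sum ?nomeM -/q //.
  case: b {u}; first by rewrite natrM; ring.
  have N21 : (N ^ 2 - 1)%N%:R != 0 :> C.
    rewrite pnatr_eq0 subn_eq0 -ltnNge -mulnn.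
    exact: leq_trans (leq_mul (prime_gt1 pN) (prime_gt1 pN)).
  have N2 : (N ^ 2)%:R = (N ^ 2 - 1)%N%:R + 1 :> C.
    by rewrite natr1 subn1 prednK // expn_gt0 N0.
  rewrite bigE natrM N2.
  have : 24%:R * (ell N)%:R = (rk N)%:R * (N ^ 2 - 1)%N%:R :> C by rewrite -!natrM ellE.
  exact: E2N_combination.
apply: cvg_fin_start; rewrite /u; case: b {u}.
  exact/cvg_seriesZ/sigma1_series.
apply: cvg_seriesB; apply: cvg_seriesZ; last exact: sigma1_series.
exact: dilate_sigma1_series.
Qed.

End Limit.

Unset Implicit Arguments.

Theorem theorem3 (R : realType) (N : nat)
    (B G : 'M[Cplx R]_(24 * ell N)) (s : 'S_(bigM N)) :
  prime N ->
  B^T = B -> B \in unitmx ->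
  G *m B *m G^T = B ->
  has_order G N ->
  char_poly G = ('X^N - 1) ^+ (bigM N %/ N) %/ ('X - 1) ^+ rk N ->
  cycle_shape s N (bigM N %/ N) ->
  [/\ virtual_graded_module (r := rk N) N G s,
      ~ findim [set: Wtw (Cplx R) (24 * ell N) (bigM N) (rk N)],
      forall (g : 'Z_N) (tau : Cplx R), 0 < complex.Im tau ->
        series (fun n => virtual_trace (r := rk N) G s g n * nome tau ^+ n) @ \oo
          --> Fg N (g == 0) tau
    & forall (k : int) (tau : Cplx R), 0 < complex.Im tau ->
        series (fun n => weighted_trace (r := rk N) G s k n * nome tau ^+ n) @ \oo
          --> Fg N (N %| k)%Z tau].
Proof.
move=> pN _ _ _ [GN _] cG sN.
have [ellE bigE rM ell0] := ell_spec pN.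
have dM : (24 * ell N + rk N = bigM N)%N.
  rewrite ellE bigE -{2}[rk N]muln1 -mulnDr subnK // expn_gt0.
  by rewrite prime_gt0.
have sN1 : (s ^+ N = 1)%g := cycle_shape_expgN sN.
have powE k := @gs_powE (Cplx R) _ _ (rk N) N G s pN GN sN1 k.
have wsumE j n := weighted_sum_pow (erefl (24 * ell N)%N) dM pN rM GN cG sN j n.
split.
- exact: (gs_virtual_graded_module (erefl _) dM pN GN sN1).
- by apply: W_not_findim; rewrite muln_gt0.
- move=> g tau tau0.
  (* ['Z_N] has exactly N elements only for N > 1; then the representative of g lies below N and is
     divisible by N only if it is 0. *)
  have -> : (g == 0) = (N %| (g : nat))%N.
    have gN : (g < N)%N by rewrite -[X in (_ < X)%N](Zp_cast (prime_gt1 pN)).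
    apply/eqP/idP => [-> //|]; case: (posnP g) => [g0 _|g0 /(dvdn_leq g0)].
      exact: val_inj.
    by rewrite leqNgt gN.
  have [j [jk gsE]] := powE g.
  rewrite -[(N %| g)%N]/(N %| Posz g)%Z -jk.
  rewrite (_ : (fun n => _) = (fun n =>
    weighted_sum (r := rk N) (e := ell N) (G ^+ j) (s ^+ j)%g n * nome tau ^+ n)).
    under eq_fun do rewrite wsumE.
    exact: character_cvg.
  apply/funext => n; congr (_ * _); rewrite /virtual_trace gsE.
  exact: (sum_trace_on_Wnme (erefl _) dM).
move=> k tau tau0; have [j [jk gsE]] := powE k; rewrite -jk.
rewrite (_ : (fun n => _) = (fun n =>
  weighted_sum (r := rk N) (e := ell N) (G ^+ j) (s ^+ j)%g n * nome tau ^+ n)).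
  under eq_fun do rewrite wsumE.
  exact: character_cvg.
apply/funext => n; congr (_ * _); rewrite /weighted_trace gsE.
exact: (trace_on_Wn (erefl _) dM).
Qed.
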